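(* Let $H$ be a locally compact second countable group with a left-invariant metric $d$, acting on a probability space $(X,\mu)$, and suppose the action is exponentially mixing of all orders on an $H$-invariant subalgebra $\mathcal{A}$ of $L^\infty(X,\mu)$ with respect to $d$ and a family of seminorms $(N_s)$ as described in the context. Let $(\nu_T)$ be a sequence of positive finite Borel measures on $H$ with $\|\nu_T\|\to\infty$, such that for every integer $r\ge3$ and real $c>0$, $$\lim_{T\to\infty}\int_H \nu_T\big(B_d(h,c\log\|\nu_T\|)\big)^{r-1}\,d\nu_T(h)=0.$$ Let $f\in\mathcal{A}$ with $\mu(f)=0$ and suppose the limit $\sigma_f:=\lim_{T\to\infty}\|\nu_T*f\|_{L^2}<\infty$ exists. Then $\nu_T*f\implies N(0,\sigma_f^2)$ as $T\to\infty$.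
   Context: $\|\nu\|$ is the total mass of $\nu$, $B_d(h,\rho)$ the $d$-ball of radius $\rho$ about $h$, and $\nu*f=\int_H (h\cdot f)\,d\nu(h)$, where $h\cdot f=f\circ h^{-1}$. The action is jointly measurable and measure-preserving. $\mathcal{A}\subset L^\infty(X,\mu)$ is an $H$-invariant subalgebra and $(N_s)_{s\ge1}$ seminorms on $\mathcal{A}$ such that for all $s\ge1$, $f,f_1,f_2\in\mathcal{A}$, $h\in H$ (implied constants depending only on $s$): $N_s(f)\ll N_{s+1}(f)$; $\|f\|_{L^\infty}\ll N_s(f)$; there is $\sigma_s>0$ with $N_s(h\cdot f)\ll e^{\sigma_s d(h,e)}N_s(f)$; $N_s(f_1f_2)\ll N_{s+1}(f_1)N_{s+1}(f_2)$. Exponential mixing of all orders: for every integer $r\ge2$ there exist $\delta_r>0$ and an integer $s_r>0$ such that for all $s>s_r$, $f_1,\dots,f_r\in\mathcal{A}$, $h_1,\dots,h_r\in H$: $\big|\mu(\prod_i h_i\cdot f_i)-\prod_i\mu(f_i)\big|\le C_{r,s}e^{-\delta_r\min_{i\ne j}d(h_i,h_j)}\prod_i N_s(f_i)$. Convergence $\implies$ is convergence in distribution with respect to $\mu$. *)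

(* Defs.v *)
From HB Require Import structures.
From mathcomp Require Import all_boot all_order all_algebra.
From mathcomp Require Import all_classical all_reals all_analysis.
Set Implicit Arguments. Unset Strict Implicit. Unset Printing Implicit Defensive.
Import Order.TTheory GRing.Theory Num.Theory.
Import numFieldNormedType.Exports.
Local Open Scope classical_set_scope.
Local Open Scope ring_scope.

Definition lcsc_group_with_left_invariant_metric {R : realType}
    (H : pseudoPMetricType R) (mul : H -> H -> H) (inv : H -> H) (e : H)
    (d : H -> H -> R) : Prop :=
  [/\
      [/\ (forall x y z, mul x (mul y z) = mul (mul x y) z),
          (forall x, mul e x = x /\ mul x e = x) &
          (forall x, mul (inv x) x = e /\ mul x (inv x) = e)],
      continuous (fun p : H * H => mul p.1 p.2) /\ continuous inv,
      [/\ locally_compact [set: H], @second_countable H & hausdorff_space H],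
      [/\ (forall x y, 0 <= d x y), (forall x y, d x y = 0 <-> x = y),
          (forall x y, d x y = d y x),
          (forall x y z, d x z <= d x y + d y z) &
          (forall x (eps : R), 0 < eps -> ball x eps = [set y | d x y < eps])] &
      (forall g x y, d (mul g x) (mul g y) = d x y)].

Notation borel_of H := (g_sigma_algebraType (@open H)).

Definition dball {R : realType} {H : Type} (d : H -> H -> R) (h : H) (rho : R)
  : set H := [set g | d h g < rho].

Definition mp_action {R : realType} (H : pseudoPMetricType R)
    (mul : H -> H -> H) (e : H) {dX : measure_display} {X : measurableType dX}
    (mu : probability X R) (act : H -> X -> X) : Prop :=
  [/\ (forall x, act e x = x),
      (forall g h x, act (mul g h) x = act g (act h x)),
      measurable_fun [set: (borel_of H * X)%type]
        (fun p : borel_of H * X => act p.1 p.2) &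
      (forall h (A : set X), measurable A -> mu (act h @^-1` A) = mu A)].

Definition translate {H X R : Type} (inv : H -> H) (act : H -> X -> X)
  (h : H) (f : X -> R) : X -> R := fun x => f (act (inv h) x).

Definition mean {R : realType} {dX : measure_display} {X : measurableType dX}
  (mu : probability X R) (f : X -> R) : R :=
  fine (\int[mu]_x (f x)%:E)%E.

(* A is an H-invariant subalgebra of L^infty(X, mu) (elements represented by
   measurable, essentially bounded functions). *)
Definition invariant_subalgebra {R : realType} {H : Type}
    {dX : measure_display} {X : measurableType dX} (mu : probability X R)
    (inv : H -> H) (act : H -> X -> X) (A : set (X -> R)) : Prop :=
  [/\ (forall f, A f -> measurable_fun [set: X] f /\
         exists M : R, {ae mu, forall x, `|f x| <= M}),
      A (fun _ => 0) /\
      (forall f g, A f -> A g -> A (fun x => f x + g x)),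
      (forall (a : R) f, A f -> A (fun x => a * f x)),
      (forall f g, A f -> A g -> A (fun x => f x * g x)) &
      (forall h f, A f -> A (translate inv act h f))].

Definition admissible_seminorms {R : realType} {H : Type}
    {dX : measure_display} {X : measurableType dX} (mu : probability X R)
    (inv : H -> H) (e : H) (d : H -> H -> R) (act : H -> X -> X)
    (A : set (X -> R)) (N : nat -> (X -> R) -> R) : Prop :=
  forall s : nat, (1 <= s)%N ->
  [/\
      [/\ (forall f, A f -> 0 <= N s f),
        (forall f g, A f -> A g -> N s (fun x => f x + g x) <= N s f + N s g) &
        (forall (a : R) f, A f -> N s (fun x => a * f x) = `|a| * N s f)],
      (exists C : R, forall f, A f -> N s f <= C * N s.+1 f),
      (exists C : R, forall f, A f -> {ae mu, forall x, `|f x| <= C * N s f}),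
      (exists sigma : R, 0 < sigma /\ exists C : R, forall h f, A f ->
         N s (translate inv act h f) <= C * expR (sigma * d h e) * N s f) &
      (exists C : R, forall f1 f2, A f1 -> A f2 ->
         N s (fun x => f1 x * f2 x) <= C * N s.+1 f1 * N s.+1 f2)].

Definition min_pair_dist {R : realType} {H : Type} (d : H -> H -> R) (r : nat)
  (h : 'I_r -> H) : R :=
  inf [set t | exists i j : 'I_r, i != j /\ t = d (h i) (h j)].

Definition exp_mixing_all_orders {R : realType} {H : Type}
    {dX : measure_display} {X : measurableType dX} (mu : probability X R)
    (inv : H -> H) (d : H -> H -> R) (act : H -> X -> X)
    (A : set (X -> R)) (N : nat -> (X -> R) -> R) : Prop :=
  forall r : nat, (2 <= r)%N ->
  exists delta : R, 0 < delta /\ exists sr : nat, (0 < sr)%N /\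
  forall s : nat, (sr < s)%N -> exists C : R,
  forall (f : 'I_r -> X -> R) (h : 'I_r -> H), (forall i, A (f i)) ->
    `| mean mu (fun x => \prod_(i < r) translate inv act (h i) (f i) x)
       - \prod_(i < r) mean mu (f i) |
    <= C * expR (- delta * min_pair_dist d h) * \prod_(i < r) N s (f i).

Definition conv_action {R : realType} (H : pseudoPMetricType R)
    (inv : H -> H) {X : Type} (act : H -> X -> X)
    (nu : {measure set (borel_of H) -> \bar R}) (f : X -> R) : X -> R :=
  fun x => fine (\int[nu]_h (translate inv act h f x)%:E)%E.

(* E[phi(Z)] for Z ~ N(0, sigma^2); N(0,0) is the Dirac mass at 0. *)
Definition centered_gaussian_expect {R : realType} (sigma : R) (phi : R -> R)
  : R :=
  if sigma == 0 then phi 0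
  else fine (\int[normal_prob 0 sigma]_y (phi y)%:E)%E.

Definition cvg_dist_to_centered_gaussian {R : realType}
    {dX : measure_display} {X : measurableType dX} (mu : probability X R)
    (F : nat -> X -> R) (sigma : R) : Prop :=
  forall phi : R -> R, continuous phi -> (exists M : R, forall y, `|phi y| <= M) ->
    (fun T => fine (\int[mu]_x (phi (F T x))%:E)%E) @ \oo -->
      centered_gaussian_expect sigma phi.

(* Main.v *)
(* Moments instead of cumulants.  Write F = nu_T * f, n = ||nu_T||, and truncate f
   to a bounded function (this changes F only on a null set).  For fixed h, split
   F = near + far according to the ball B(h, b log n).  A clustering argument shows
   that, with errors O(n^(-L)) for any prescribed L, the factor h.f is uncorrelated
   with far^(m+2), and (h.f) near is uncorrelated with far^(m+1); every term of
   F^(m+2) containing near at least twice is controlled by nu_T(B(h, b log n))^2,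
   whose nu_T-integral tends to 0.  Integrating over h gives

     E F^(m+3) = (m+2) E(F^2) E F^(m+1) + o(1),

   the Gaussian recursion.  Hence all moments converge to those of N(0, sigma^2).
   Taylor expansion then gives convergence of E cos(t F + c), hence of the
   expectation of polynomials in sin(a F), and by Weierstrass approximation these
   approximate bounded continuous test functions, with an error which is small on a
   large interval and bounded outside. *)

Require Import Defs.
From HB Require Import structures.
From mathcomp Require Import all_boot all_order all_algebra.
From mathcomp Require Import all_classical all_reals all_analysis.
From mathcomp Require Import measurable_realfun zify ring lra.
Import Order.TTheory GRing.Theory Num.Theory.
Import numFieldNormedType.Exports.
Local Open Scope classical_set_scope.
Local Open Scope ring_scope.

Set Implicit Arguments.
Unset Strict Implicit.
Unset Printing Implicit Defensive.

(** * Bounded measurable functions *)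

(** Three obstacles shape the proof. Elements of [A] are bounded only almost everywhere, and a
    truncation need not lie in [A]: integrals are therefore computed with the truncation, whose
    bound everywhere justifies each exchange of integrals, and correlations are carried back to [f],
    where mixing applies, by almost sure equality. Next, the mixing rate is given and depends on the
    number of factors, while the error must beat the power n^(m+3) produced by m+3 integrations over
    the group. Distances are therefore measured in units of t = log n, and the radius b is chosen
    after the exponent L. Merging close factors multiplies a seminorm by an exponential of t; this
    is paid for by demanding a larger L of the merged product. Finally, the error of the recursion
    contains the absolute moment of order m, which for odd m is not a moment; an even moment of
    order at most m+1 dominates it, so the induction over orders is a strong one. The Gaussian law
    enters only through its moment recursion, which also holds for the constant 0 when the variance
    vanishes. *)

Lemma ler_eq {R : numDomainType} (x y : R) : x = y -> x <= y.
Proof. by move->. Qed.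

Section bounded_mfun.
Context {d : measure_display} {T : measurableType d} {R : realType}.
Implicit Types f g : T -> R.

Definition bounded_mfun f :=
  measurable_fun [set: T] f /\ exists M : R, forall x, `|f x| <= M.

Lemma bounded_mfun_cst (c : R) : bounded_mfun (fun _ => c).
Proof. by split=> //; exists `|c|. Qed.

Lemma bounded_mfunD f g : bounded_mfun f -> bounded_mfun g ->
  bounded_mfun (fun x => f x + g x).
Proof.
move=> [mf [M fM]] [mg [K gK]]; split; first exact: measurable_funD.
by exists (M + K) => x; rewrite (le_trans (ler_normD _ _))// lerD.
Qed.

Lemma bounded_mfunM f g : bounded_mfun f -> bounded_mfun g ->
  bounded_mfun (fun x => f x * g x).
Proof.
move=> [mf [M fM]] [mg [K gK]]; split; first exact: measurable_funM.
by exists (M * K) => x; rewrite normrM ler_pM.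
Qed.

Lemma bounded_mfunZ (c : R) f : bounded_mfun f -> bounded_mfun (fun x => c * f x).
Proof. exact/bounded_mfunM/bounded_mfun_cst. Qed.

Lemma bounded_mfunB f g : bounded_mfun f -> bounded_mfun g ->
  bounded_mfun (fun x => f x - g x).
Proof.
move=> [mf [M fM]] [mg [K gK]]; split; first exact: measurable_funB.
by exists (M + K) => x; rewrite (le_trans (ler_normB _ _))// lerD.
Qed.

Lemma bounded_mfunX f n : bounded_mfun f -> bounded_mfun (fun x => f x ^+ n).
Proof.
move=> [mf [M fM]]; split; first exact: measurable_funX.
by exists (M ^+ n) => x; rewrite normrX lerXn2r// ?nnegrE ?(le_trans _ (fM x)).
Qed.

Lemma bounded_mfun_norm f : bounded_mfun f -> bounded_mfun (fun x => `|f x|).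
Proof.
move=> [mf [M fM]]; split; first exact: measurableT_comp.
by exists M => x; rewrite normr_id.
Qed.

Lemma bounded_mfun_prod (I : Type) (r : seq I) (F : I -> T -> R) :
  (forall i, bounded_mfun (F i)) -> bounded_mfun (fun x => \prod_(i <- r) F i x).
Proof.
move=> bF; elim: r => [|i r IH].
  by under eq_fun do rewrite big_nil; exact: bounded_mfun_cst.
by under eq_fun do rewrite big_cons; exact: bounded_mfunM.
Qed.

Variable mu : {finite_measure set T -> \bar R}.

Lemma bounded_mfun_integrable (D : set T) f : measurable D -> bounded_mfun f ->
  mu.-integrable D (EFin \o f).
Proof.
move=> mD [mf [M fM]]; apply: measurable_bounded_integrable => //.
- by rewrite ltey_eq fin_num_measure.
- exact: measurable_funTS.
- exists M; split; first exact: num_real.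
  by move=> K MK x _ /=; apply: le_trans (fM x) (ltW MK).
Qed.

Lemma normr_Rintegral_bounded (D : set T) f (M : R) : measurable D ->
  bounded_mfun f -> (forall x, D x -> `|f x| <= M) ->
  `|\int[mu]_(x in D) f x| <= M * fine (mu D).
Proof.
move=> mD bf fM.
rewrite (le_trans (le_normr_Rintegral mD (bounded_mfun_integrable mD bf)))//.
rewrite -(Rintegral_cst mu mD M); apply: le_Rintegral => //.
- exact/bounded_mfun_integrable/bounded_mfun_norm.
- exact/bounded_mfun_integrable/bounded_mfun_cst.
Qed.

End bounded_mfun.

Section mean_bounded.
Context {d : measure_display} {T : measurableType d} {R : realType}.
Variable mu : probability T R.
Implicit Types f g : T -> R.

Lemma mean_cst (c : R) : \int[mu]_x c = c.
Proof. by rewrite (Rintegral_cst mu measurableT)/= probability_setT mulr1. Qed.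

Lemma meanD f g : bounded_mfun f -> bounded_mfun g ->
  \int[mu]_x (f x + g x) = \int[mu]_x f x + \int[mu]_x g x.
Proof. by move=> bf bg; apply: RintegralD => //; exact: bounded_mfun_integrable. Qed.

Lemma meanB f g : bounded_mfun f -> bounded_mfun g ->
  \int[mu]_x (f x - g x) = \int[mu]_x f x - \int[mu]_x g x.
Proof. by move=> bf bg; apply: RintegralB => //; exact: bounded_mfun_integrable. Qed.

Lemma meanZ (c : R) f : bounded_mfun f ->
  \int[mu]_x (c * f x) = c * \int[mu]_x f x.
Proof. by move=> bf; apply: RintegralZl => //; exact: bounded_mfun_integrable. Qed.

Lemma le_mean f g : bounded_mfun f -> bounded_mfun g ->
  (forall x, f x <= g x) -> \int[mu]_x f x <= \int[mu]_x g x.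
Proof. by move=> bf bg fg; apply: le_Rintegral => //; exact: bounded_mfun_integrable. Qed.

Lemma norm_mean_le f g : bounded_mfun f -> bounded_mfun g ->
  (forall x, `|f x| <= g x) -> `|\int[mu]_x f x| <= \int[mu]_x g x.
Proof.
move=> bf bg fg; apply: (le_trans (le_normr_Rintegral _ _)) => //.
  exact: bounded_mfun_integrable.
by apply: le_mean => //; exact: bounded_mfun_norm.
Qed.

Lemma norm_mean_le_cst f (M : R) : bounded_mfun f -> (forall x, `|f x| <= M) ->
  `|\int[mu]_x f x| <= M.
Proof.
move=> bf fM; rewrite -[leRHS]mean_cst; apply: norm_mean_le => //.
exact: bounded_mfun_cst.
Qed.

End mean_bounded.

(** * Exchange of integrals for bounded kernels and finite measures *)

Section fubini_bounded.
Context {d1 d2 : measure_display} {T1 : measurableType d1}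
  {T2 : measurableType d2} {R : realType}.
Variables (m1 : {finite_measure set T1 -> \bar R})
  (m2 : {finite_measure set T2 -> \bar R}).
Implicit Types K : T1 * T2 -> R.

Lemma bounded_mfun_pair1 K x : bounded_mfun K -> bounded_mfun (fun y => K (x, y)).
Proof.
move=> [mK [M KM]]; split; last by exists M.
exact: (measurableT_comp mK (measurable_pair1 x)).
Qed.

Lemma bounded_mfun_pair2 K y : bounded_mfun K -> bounded_mfun (fun x => K (x, y)).
Proof.
move=> [mK [M KM]]; split; last by exists M.
exact: (measurableT_comp mK (measurable_pair2 y)).
Qed.

Lemma bounded_mfun_fst (f : T1 -> R) :
  bounded_mfun f -> bounded_mfun (fun p : T1 * T2 => f p.1).
Proof.
move=> [mf [M fM]]; split; last by exists M.
exact: (measurableT_comp mf measurable_fst).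
Qed.

Lemma bounded_mfun_snd (f : T2 -> R) :
  bounded_mfun f -> bounded_mfun (fun p : T1 * T2 => f p.2).
Proof.
move=> [mf [M fM]]; split; last by exists M.
exact: (measurableT_comp mf measurable_snd).
Qed.

Let integrable_prod K : bounded_mfun K -> (m1 \x m2)%E.-integrable setT (EFin \o K).
Proof.
move=> [mK [M KM]]; apply/integrable12ltyP; first exact/measurable_EFinP.
apply: (@le_lt_trans _ _ (\int[m1]_x (M * fine (m2 setT))%:E)%E).
  apply: ge0_le_integral => //.
  - by move=> x _; exact: integral_ge0.
  - apply: (measurable_fun_fubini_tonelli_F (abse \o (EFin \o K))) => //=.
    by apply/measurableT_comp => //; exact/measurable_EFinP.
  - move=> x _; rewrite EFinM fineK ?fin_num_measure// -integral_cst//.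
    apply: ge0_le_integral => //.
    + apply/measurableT_comp => //; apply/measurable_EFinP.
      exact: (measurableT_comp mK (measurable_pair1 x)).
    + by move=> y _; rewrite lee_fin.
by rewrite integral_cst//= ltey_eq fin_numM// fin_num_measure.
Qed.

Let RintegralE1 K x : bounded_mfun K ->
  (\int[m2]_y K (x, y))%:E = (\int[m2]_y (K (x, y))%:E)%E.
Proof.
move=> bK; rewrite fineK//; apply: integrable_fin_num => //.
exact/bounded_mfun_integrable/bounded_mfun_pair1.
Qed.

Let RintegralE2 K y : bounded_mfun K ->
  (\int[m1]_x K (x, y))%:E = (\int[m1]_x (K (x, y))%:E)%E.
Proof.
move=> bK; rewrite fineK//; apply: integrable_fin_num => //.
exact/bounded_mfun_integrable/bounded_mfun_pair2.
Qed.

Lemma bounded_mfun_Rintegral1 K : bounded_mfun K ->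
  bounded_mfun (fun x => \int[m2]_y K (x, y)).
Proof.
move=> bK; split; last first.
  have [_ [M KM]] := bK; exists (M * fine (m2 setT)) => x.
  by apply: normr_Rintegral_bounded => //; exact: bounded_mfun_pair1.
apply/measurable_EFinP => /=; under [X in measurable_fun _ X]eq_fun do rewrite /= RintegralE1//.
exact: (measurable_fubini_F (integrable_prod bK)).
Qed.

Lemma bounded_mfun_Rintegral2 K : bounded_mfun K ->
  bounded_mfun (fun y => \int[m1]_x K (x, y)).
Proof.
move=> bK; split; last first.
  have [_ [M KM]] := bK; exists (M * fine (m1 setT)) => y.
  by apply: normr_Rintegral_bounded => //; exact: bounded_mfun_pair2.
apply/measurable_EFinP => /=; under [X in measurable_fun _ X]eq_fun do rewrite /= RintegralE2//.
exact: (measurable_fubini_G (integrable_prod bK)).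
Qed.

Lemma RFubini K : bounded_mfun K ->
  \int[m1]_x \int[m2]_y K (x, y) = \int[m2]_y \int[m1]_x K (x, y).
Proof.
move=> bK; rewrite /Rintegral; congr fine.
under eq_integral do rewrite RintegralE1//.
under [RHS]eq_integral do rewrite RintegralE2//.
exact: (Fubini (integrable_prod bK)).
Qed.

End fubini_bounded.

Section fubini_weighted.
Context {d1 d2 : measure_display} {T1 : measurableType d1}
  {T2 : measurableType d2} {R : realType}.
Variables (m1 : {finite_measure set T1 -> \bar R})
  (m2 : {finite_measure set T2 -> \bar R}).
Variables (k : T1 * T2 -> R) (D : set T1).
Hypotheses (bk : bounded_mfun k) (mD : measurable D).

Let restrictE y : (fun x => k (x, y)) \_ D = (fun x => \1_D x * k (x, y)).
Proof.
by apply/funext => x; rewrite patchE indicE; case: ifPn; rewrite ?mul1r ?mul0r.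
Qed.

Let b1 : bounded_mfun (fun p : T1 * T2 => \1_D p.1 * k p).
Proof.
apply: bounded_mfunM => //; apply: bounded_mfun_fst; split=> //.
by exists 1 => x; rewrite indicE; case: (_ \in _); rewrite ?normr1 ?normr0.
Qed.

Lemma bounded_mfun_section_Rintegral :
  bounded_mfun (fun y => \int[m1]_(x in D) k (x, y)).
Proof.
under eq_fun do rewrite Rintegral_mkcond restrictE.
exact: (bounded_mfun_Rintegral2 m1 m2 b1).
Qed.

(** The set [D] is absorbed into the kernel as an indicator, which reduces the exchange to the
    unrestricted one. *)
Lemma RFubini_weighted (G : T2 -> R) : bounded_mfun G ->
  \int[m2]_y (G y * \int[m1]_(x in D) k (x, y)) =
  \int[m1]_(x in D) \int[m2]_y (G y * k (x, y)).
Proof.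
move=> bG.
have b2 := bounded_mfunM b1 (bounded_mfun_snd bG).
rewrite [RHS]Rintegral_mkcond.
transitivity (\int[m2]_y \int[m1]_x (\1_D x * k (x, y) * G y)).
  apply: eq_Rintegral => y _; rewrite Rintegral_mkcond restrictE mulrC.
  rewrite -RintegralZr//; apply: bounded_mfun_integrable => //.
  exact: (bounded_mfun_pair2 y b1).
rewrite -(RFubini m1 m2 b2); apply: eq_Rintegral => x _ /=.
rewrite patchE indicE; case: ifPn => xD.
  by apply: eq_Rintegral => y _ /=; rewrite mul1r mulrC.
by under eq_Rintegral do rewrite !mul0r; rewrite Rintegral_cst// mul0r.
Qed.

End fubini_weighted.

(** * Decorrelation of separated clusters *)

(** Exposes two close factors of a product so that they can be merged into one. *)
Lemma split_two (T : Type) (x0 : T) (l : seq T) i j : (i < j < size l)%N ->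
  exists l1 l2 l3, l = l1 ++ nth x0 l i :: l2 ++ nth x0 l j :: l3.
Proof.
move=> /andP[ij jl]; have il := ltn_trans ij jl.
exists (take i l), (take (j - i.+1) (drop i.+1 l)), (drop j.+1 l).
rewrite -[LHS](cat_take_drop i) (drop_nth x0 il); congr (_ ++ _ :: _).
rewrite -[LHS](cat_take_drop (j - i.+1)) drop_drop addnC subnKC//.
by rewrite (drop_nth x0 jl).
Qed.

(** * Truncation of essentially bounded functions *)

Section clip.
Context {d : measure_display} {T : measurableType d} {R : realType}.
Implicit Types (f g : T -> R) (M : R).

(** For [M] an essential bound of [f], this is a representative of [f] that is bounded
    everywhere. *)
Definition clip M f x : R := Num.max (- M) (Num.min M (f x)).

Lemma norm_clip_le M f x : 0 <= M -> `|clip M f x| <= M.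
Proof.
move=> M0; rewrite ler_norml /clip le_max lexx/= ge_max ge_min lexx/= andbT.
by rewrite (le_trans _ M0)// oppr_le0.
Qed.

Lemma bounded_mfun_clip M f : 0 <= M -> measurable_fun [set: T] f ->
  bounded_mfun (clip M f).
Proof.
move=> M0 mf; split; last by exists M => x; exact: norm_clip_le.
by apply: measurable_maxr => //; exact: measurable_minr.
Qed.

Lemma clip_id M f x : `|f x| <= M -> clip M f x = f x.
Proof. by rewrite ler_norml /clip => /andP[? ?]; rewrite min_r// max_r. Qed.

Variable mu : probability T R.

Lemma ae_eq_mean f g : measurable_fun setT f -> measurable_fun setT g ->
  {ae mu, forall x, f x = g x} -> \int[mu]_x f x = \int[mu]_x g x.
Proof.
move=> mf mg fg; congr fine; apply: ae_eq_integral => //; do ?exact/measurable_EFinP.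
by apply: filterS fg => x -> _.
Qed.

Lemma norm_mean_le_ae f M : 0 <= M -> measurable_fun setT f ->
  {ae mu, forall x, `|f x| <= M} -> `|\int[mu]_x f x| <= M.
Proof.
move=> M0 mf fM; have [mc _] := bounded_mfun_clip M0 mf.
rewrite (ae_eq_mean mf mc); last first.
  by apply: filterS fM => x /clip_id.
by apply: norm_mean_le_cst => [|x]; [exact: bounded_mfun_clip|exact: norm_clip_le].
Qed.

End clip.

(** * Translates under a measure-preserving action *)

Section action.
Context {R : realType} {H : pseudoPMetricType R}.
Variables (mul : H -> H -> H) (inv : H -> H) (e : H) (d : H -> H -> R).
Context {dX : measure_display} {X : measurableType dX}.
Variables (mu : probability X R) (act : H -> X -> X).
Hypothesis groupH : lcsc_group_with_left_invariant_metric mul inv e d.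
Hypothesis actH : mp_action mul e mu act.
Implicit Types (f : X -> R) (g h : H).
Local Notation tr := (translate inv act).

Lemma measurable_act h : measurable_fun setT (act h).
Proof.
case: actH => _ _ mact _.
exact: (measurableT_comp mact (@measurable_pair1 _ _ (borel_of H) X h)).
Qed.

(** The exceptional null set is pulled back by [act h], and invariance of [mu] keeps it null. *)
Lemma ae_act h (P : X -> Prop) :
  {ae mu, forall x, P x} -> {ae mu, forall x, P (act h x)}.
Proof.
case: actH => _ _ _ mp [Z [mZ Z0 PZ]].
exists (act h @^-1` Z); split => //.
- by rewrite -[X in measurable X]setTI; exact: measurable_act.
- by rewrite mp.
- by move=> x /= nP; exact: PZ.
Qed.

Lemma measurable_translate h f : measurable_fun setT f -> measurable_fun setT (tr h f).
Proof. by move=> mf; exact: (measurableT_comp mf (measurable_act _)). Qed.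

Lemma bounded_mfun_translate h f : bounded_mfun f -> bounded_mfun (tr h f).
Proof.
move=> [mf [M fM]]; split; first exact: measurable_translate.
by exists M => x; exact: fM.
Qed.

Lemma mean_translate_bounded h f : bounded_mfun f ->
  \int[mu]_x tr h f x = \int[mu]_x f x.
Proof.
move=> bf; have [mf _] := bf; congr fine.
transitivity (\int[pushforward mu (act (inv h))]_x (f x)%:E)%E.
  rewrite integral_pushforward//=.
  - exact: measurable_act.
  - exact/measurable_EFinP.
  - rewrite preimage_setT; apply: bounded_mfun_integrable => //.
    exact: (bounded_mfun_translate h bf).
by apply: eq_measure_integral => [|? B mB _]; [exact: measurable_act|case: actH => _ _ _; exact].
Qed.

Lemma mean_translate h f (M : R) : measurable_fun setT f ->
  {ae mu, forall x, `|f x| <= M} -> \int[mu]_x tr h f x = \int[mu]_x f x.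
Proof.
move=> mf fM.
have fM' : {ae mu, forall x, `|f x| <= `|M|}.
  by apply: filterS fM => x /le_trans; apply; exact: ler_norm.
have bc := bounded_mfun_clip (normr_ge0 M) mf.
transitivity (\int[mu]_x tr h (clip `|M| f) x).
  apply: ae_eq_mean; do ?exact: measurable_translate.
    by apply: measurable_translate; case: bc.
  by have := ae_act (inv h) fM'; apply: filterS => x /clip_id.
rewrite mean_translate_bounded//; apply: ae_eq_mean => //; first by case: bc.
by apply: filterS fM' => x /clip_id.
Qed.

Lemma invM g h : inv (mul g h) = mul (inv h) (inv g).
Proof.
case: groupH => -[mulA mul1 mulV] _ _ _ _.
have E : mul (mul g h) (mul (inv h) (inv g)) = e.
  by rewrite mulA -(mulA g) (mulV h).2 (mul1 g).2 (mulV g).2.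
by rewrite -[LHS](mul1 _).2 -E mulA (mulV _).1 (mul1 _).1.
Qed.

Lemma translate_mul g h f x : tr g (tr h f) x = tr (mul g h) f x.
Proof. by rewrite /translate invM; case: actH => _ -> _ _. Qed.

(** Lets a product of translates by [g] and by [h] be read as one translate by [g] of an element of
    the algebra. *)
Lemma translate_factor g h f x : tr g (tr (mul (inv g) h) f) x = tr h f x.
Proof.
rewrite translate_mul; case: groupH => -[mulA mul1 mulV] _ _ _ _.
by rewrite mulA (mulV _).2 (mul1 _).1.
Qed.

Lemma dist_sym g h : d g h = d h g.
Proof. by case: groupH => _ _ _ []. Qed.

Lemma dist_triangle g h k : d g k <= d g h + d h k.
Proof. by case: groupH => _ _ _ []. Qed.

Lemma dist_quotient g h : d (mul (inv g) h) e = d g h.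
Proof.
case: groupH => -[mulA mul1 mulV] _ _ _ linv.
by rewrite -(linv g) mulA (mulV _).2 (mul1 _).1 (mul1 _).2 dist_sym.
Qed.

End action.

Section decorrelation.
Context {R : realType} {H : pseudoPMetricType R}.
Variables (mul : H -> H -> H) (inv : H -> H) (e : H) (d : H -> H -> R).
Context {dX : measure_display} {X : measurableType dX}.
Variables (mu : probability X R) (act : H -> X -> X).
Variables (A : set (X -> R)) (N : nat -> (X -> R) -> R).
Hypothesis groupH : lcsc_group_with_left_invariant_metric mul inv e d.
Hypothesis actH : mp_action mul e mu act.
Hypothesis algA : invariant_subalgebra mu inv act A.
Hypothesis semiN : admissible_seminorms mu inv e d act A N.
Hypothesis mixing : exp_mixing_all_orders mu inv d act A N.
Implicit Types (f phi : X -> R) (g h : H) (l : seq (H * (X -> R))).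
Local Notation tr := (translate inv act).

Lemma algebra_measurable f : A f -> measurable_fun setT f.
Proof. by case: algA => + _ _ _ _ Af => /(_ f Af)[]. Qed.

Lemma algebra_translate h f : A f -> A (tr h f).
Proof. by case: algA => _ _ _ _; exact. Qed.

Lemma algebra_mul f1 f2 : A f1 -> A f2 -> A (fun x => f1 x * f2 x).
Proof. by case: algA => _ _ _ + _; exact. Qed.

Lemma algebra_mean_translate h f : A f -> \int[mu]_x tr h f x = \int[mu]_x f x.
Proof.
case: algA => + _ _ _ _ Af => /(_ f Af)[mf [M fM]].
exact: (mean_translate inv actH h mf fM).
Qed.

Lemma seminorm_ge0 s f : (0 < s)%N -> A f -> 0 <= N s f.
Proof. by move=> s0; case: (semiN s0) => -[+ _ _] _ _ _ _; exact. Qed.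

Lemma seminorm_mono s s' : (0 < s)%N -> (s <= s')%N ->
  exists2 C : R, 0 <= C & forall f, A f -> N s f <= C * N s' f.
Proof.
move=> s0 /subnKC <-; elim: (s' - s)%N => [|k [C C0 IH]].
  by exists 1 => // f _; rewrite addn0 mul1r.
have sk0 : (0 < s + k)%N by rewrite addn_gt0 s0.
have [_ [K NK] _ _ _] := semiN sk0.
exists (C * `|K|); first by rewrite mulr_ge0.
move=> f Af; rewrite (le_trans (IH f Af))// -mulrA ler_wpM2l// addnS.
rewrite (le_trans (NK f Af))// ler_wpM2r ?ler_norm// seminorm_ge0//.
Qed.

Lemma norm_mean_seminorm s : (0 < s)%N ->
  exists2 C : R, 0 <= C & forall f, A f -> `|\int[mu]_x f x| <= C * N s f.
Proof.
move=> s0; have [_ _ [C NC] _ _] := semiN s0; exists `|C| => // f Af.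
have NCf : C * N s f <= `|C| * N s f by rewrite ler_wpM2r ?ler_norm// seminorm_ge0.
apply: norm_mean_le_ae; first by rewrite mulr_ge0// seminorm_ge0.
- exact: algebra_measurable.
- by apply: filterS (NC f Af) => x /le_trans; apply.
Qed.

(** Each point carries its own function, because merging two factors produces one factor with a new
    function. *)
Definition tprod l x : R := \prod_(p <- l) tr p.1 p.2 x.

(** Mixing for lists, with any common lower bound [D] of the distances in place of their infimum.
    Mixing is assumed from two factors on; with none or one the difference vanishes, for a single
    factor by invariance of [mu]. *)
Lemma mixing_seq (k : nat) : exists2 delta : R, 0 < delta & exists sr : nat,
  forall s, (sr < s)%N -> exists2 C : R, 0 <= C &
  forall l (D : R), size l = k -> (forall p, p \in l -> A p.2) ->
  (forall i j, (i < j < k)%N ->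
     D <= d (nth (e, cst 0) l i).1 (nth (e, cst 0) l j).1) ->
  `|\int[mu]_x tprod l x - \prod_(p <- l) \int[mu]_x p.2 x|
    <= C * expR (- delta * D) * \prod_(p <- l) N s p.2.
Proof.
case: k => [|[|k]].
- exists 1 => //; exists 0%N => s _; exists 0 => // l D /size0nil -> _ _.
  rewrite !big_nil; under eq_Rintegral do rewrite /tprod big_nil.
  by rewrite mean_cst subrr normr0 !mul0r.
- exists 1 => //; exists 0%N => s _; exists 0 => // -[|p [|//]]// D _ Al _.
  rewrite !big_seq1; under eq_Rintegral do rewrite /tprod big_seq1.
  by rewrite algebra_mean_translate ?subrr ?normr0 ?mul0r//; apply: Al; rewrite mem_head.
have [//|delta [delta0 [sr [sr0 mix]]]] := mixing (r := k.+2) _.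
exists delta => //; exists sr => s srs.
have [C mixC] := mix s srs; exists `|C| => // l D sl Al lD.
pose x0 : H * (X -> R) := (e, cst 0).
pose ff (i : 'I_k.+2) := (nth x0 l i).2.
pose hh (i : 'I_k.+2) := (nth x0 l i).1.
have Aff i : A (ff i) by apply: Al; rewrite mem_nth// sl.
have bigE (F : H * (X -> R) -> R) :
    \prod_(p <- l) F p = \prod_(i < k.+2) F (nth x0 l i).
  by rewrite (big_nth x0) sl big_mkord.
have := mixC ff hh Aff; rewrite !bigE /mean => mixl.
under eq_Rintegral do rewrite /tprod bigE.
rewrite (le_trans mixl)// ler_wpM2r//.
  by apply: prodr_ge0 => i _; rewrite seminorm_ge0// (leq_ltn_trans _ srs).
rewrite (@le_trans _ _ (`|C| * expR (- delta * min_pair_dist d hh)))//.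
  by rewrite ler_wpM2r ?expR_ge0 ?ler_norm.
rewrite ler_wpM2l// ler_expR !mulNr lerN2 ler_pM2l//.
(* At least two indices exist, so the set of distances is inhabited and [inf] does not take its
   default value. *)
apply: lb_le_inf.
  by exists (d (hh ord0) (hh ord_max)), ord0, ord_max.
move=> _ [i [j [ij ->]]].
have [ij'|ji|eqij] := ltngtP i j; last by rewrite (ord_inj eqij) eqxx in ij.
- by apply: lD; rewrite ij'/=.
- by rewrite (dist_sym groupH); apply: lD; rewrite ji/=.
Qed.

(** The product rule costs one index of the seminorm; the translation costs an exponential of the
    distance from g^-1 h to [e], which left invariance turns into [d g h]. *)
Lemma seminorm_merge s : (0 < s)%N -> exists2 sg : R, 0 <= sg &
  exists2 C : R, 0 <= C & forall g h f1 f2, A f1 -> A f2 ->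
  N s (fun x => f1 x * tr (mul (inv g) h) f2 x)
    <= C * expR (sg * d g h) * N s.+1 f1 * N s.+1 f2.
Proof.
move=> s0; have [_ _ _ _ [C1 mulC]] := semiN s0.
have [_ _ _ [sg [sg0 [C2 trC]]] _] := semiN (ltn0Sn s).
exists sg; first exact: ltW.
exists (`|C1| * `|C2|); first by rewrite mulr_ge0.
move=> g h f1 f2 A1 A2; rewrite (le_trans (mulC _ _ A1 (algebra_translate _ A2)))//.
have := trC (mul (inv g) h) f2 A2; rewrite (dist_quotient groupH) => tr2.
have N1 := seminorm_ge0 (ltn0Sn s) A1; have N2 := seminorm_ge0 (ltn0Sn s) A2.
have N3 := seminorm_ge0 (ltn0Sn s) (algebra_translate (mul (inv g) h) A2).
apply: (@le_trans _ _ (`|C1| * N s.+1 f1 * N s.+1 (tr (mul (inv g) h) f2))).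
  by rewrite ler_wpM2r// ler_wpM2r// ler_norm.
apply: (@le_trans _ _ (`|C1| * N s.+1 f1 * (`|C2| * expR (sg * d g h) * N s.+1 f2))).
  rewrite ler_wpM2l ?mulr_ge0// (le_trans tr2)// ler_wpM2r//.
  by rewrite ler_wpM2r ?expR_ge0// ler_norm.
by apply: ler_eq; ring.
Qed.

Lemma prod_seminorm_mono s s' : (0 < s)%N -> (s <= s')%N ->
  exists2 C : R, 0 <= C & forall l, (forall p, p \in l -> A p.2) ->
  \prod_(p <- l) N s p.2 <= C ^+ size l * \prod_(p <- l) N s' p.2.
Proof.
move=> s0 ss'; have [C C0 NC] := seminorm_mono s0 ss'; exists C => //.
elim=> [_|p l IH Al]; first by rewrite !big_nil expr0 mulr1.
have Alq q : q \in l -> A q.2 by move=> ql; apply: Al; rewrite inE ql orbT.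
have Ap : A p.2 by apply: Al; rewrite mem_head.
rewrite !big_cons exprS mulrACA ler_pM ?NC ?IH//; first exact: seminorm_ge0.
by rewrite big_seq; apply: prodr_ge0 => q /Alq; exact: seminorm_ge0.
Qed.

(* Induction on the number of factors: either the points of [l] are pairwise
   far apart and mixing applies directly, or two of them are close and the
   corresponding factors are merged into one element of the algebra. *)
Lemma decorrelation (k : nat) : exists2 s : nat, (0 < s)%N &
  forall L : R, 0 <= L -> exists2 b : R, 0 <= b & exists2 C : R, 0 <= C &
  forall (t : R) g0 phi0 l, 0 <= t -> size l = k -> A phi0 ->
  (forall p, p \in l -> A p.2) -> (forall p, p \in l -> b * t <= d g0 p.1) ->
  `|\int[mu]_x (tr g0 phi0 x * tprod l x)
    - (\int[mu]_x phi0 x) * \int[mu]_x tprod l x|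
    <= C * expR (- L * t) * (N s phi0 * \prod_(p <- l) N s p.2).
Proof.
pose x0 : H * (X -> R) := (e, cst 0).
elim: k => [|k [s1 s10 IH]].
  exists 1%N => // L L0; exists 0 => //; exists 0 => // t g0 phi0 l t0 /size0nil ->.
  move=> A0 _ _; rewrite big_nil /tprod.
  under eq_Rintegral do rewrite big_nil mulr1.
  under [X in _ * X]eq_Rintegral do rewrite big_nil.
  by rewrite mean_cst !mulr1 algebra_mean_translate// subrr normr0 !mul0r.
have [d1 d10 [sr1 mix1]] := mixing_seq k.+2.
have [d2 d20 [sr2 mix2]] := mixing_seq k.+1.
(* One index above [s1] for the loss in merging, and above both mixing thresholds. *)
pose s := maxn s1.+1 (maxn sr1.+1 sr2.+1).
have s1s : (s1.+1 <= s)%N by rewrite leq_maxl.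
have sr1s : (sr1 < s)%N by rewrite /s !leq_max ltnSn/= orbT.
have sr2s : (sr2 < s)%N by rewrite /s !leq_max ltnSn/= !orbT.
have s0 : (0 < s)%N by exact: leq_trans s1s.
exists s => // L L0.
have [C1 C10 {}mix1] := mix1 s sr1s; have [C2 C20 {}mix2] := mix2 s sr2s.
have [K K0 meanK] := norm_mean_seminorm s0.
have [sg sg0 [Cm Cm0 merge]] := seminorm_merge s10.
have [C3 C30 mono] := seminorm_mono (ltn0Sn s1) s1s.
have [C4 C40 monop] := prod_seminorm_mono s10 (ltnW s1s).
have [C5 C50 mono1] := seminorm_mono s10 (ltnW s1s).
(* Separation [b1 * t] turns either mixing rate, [d1] or [d2], into decay at least exp(-L t). *)
pose b1 := L / d1 + L / d2.
have Ld1 : 0 <= L / d1 by rewrite divr_ge0// ltW.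
have Ld2 : 0 <= L / d2 by rewrite divr_ge0// ltW.
have b10 : 0 <= b1 by rewrite addr_ge0.
(* Merging points at distance below [b1 * t] inflates a seminorm by at most exp(sg b1 t); the
   induction hypothesis is asked for this much extra decay. *)
have [b2 b20 [C6 C60 dec]] := IH _ (addr_ge0 L0 (mulr_ge0 sg0 b10)).
exists (b1 + b2); first by rewrite addr_ge0.
(* The first two terms serve the separated case. The last is the cost of merging, after which [k.-1]
   factors are left untouched. *)
exists (C1 + C2 * K + C6 * (C5 * (Cm * C3 * C3) * C4 ^+ k.-1)).
  by rewrite !addr_ge0 ?mulr_ge0 ?exprn_ge0.
move=> t g0 phi0 l t0 sl A0 Al far.
have NP0 (l' : seq (H * (X -> R))) : (forall p, p \in l' -> A p.2) ->
    0 <= \prod_(p <- l') N s p.2.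
  by move=> Al'; rewrite big_seq; apply: prodr_ge0 => q /Al'; exact: seminorm_ge0.
have N00 := seminorm_ge0 s0 A0.
have [sep|/existsNP[i /existsNP[j /not_implyP[ij /negP]]]] := pselect (forall i j,
    (i < j < k.+1)%N -> b1 * t <= d (nth x0 l i).1 (nth x0 l j).1).
(* Mixing is applied with [g0] adjoined and without it; both correlations are compared with the
   product of all the means. *)
- pose l0 := (g0, phi0) :: l.
  have Al0 p : p \in l0 -> A p.2 by rewrite inE => /predU1P[->//|/Al].
  have expL (dl : R) : 0 < dl -> L / dl <= b1 -> expR (- dl * (b1 * t)) <= expR (- L * t).
    move=> dl0 Ldl; rewrite ler_expR !mulNr lerN2 mulrA ler_wpM2r//.
    by rewrite -ler_pdivrMl// mulrC.
  have e1 := mix1 l0 (b1 * t); have e2 := mix2 l (b1 * t) sl Al sep.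
  have {}e1 : `|\int[mu]_x (tr g0 phi0 x * tprod l x)
       - (\int[mu]_x phi0 x) * \prod_(p <- l) \int[mu]_x p.2 x|
     <= C1 * expR (- L * t) * (N s phi0 * \prod_(p <- l) N s p.2).
    have : size l0 = k.+2 by rewrite /= sl.
    move=> /e1 /(_ Al0); rewrite /tprod !big_cons/=.
    under eq_Rintegral do rewrite big_cons/=.
    move=> /(_ _)/le_trans; apply; last first.
      rewrite ler_wpM2r ?mulr_ge0 ?NP0// ler_wpM2l// expL//.
      by rewrite lerDl.
    move=> [|i] [|j]//=; last by rewrite !ltnS => /sep.
    rewrite ltnS => jk; apply: le_trans (far _ _); last by rewrite mem_nth// sl.
    by rewrite ler_wpM2r// lerDl.
  have {}e2 : `|(\int[mu]_x phi0 x) * \prod_(p <- l) \int[mu]_x p.2 x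
       - (\int[mu]_x phi0 x) * \int[mu]_x tprod l x|
     <= C2 * K * expR (- L * t) * (N s phi0 * \prod_(p <- l) N s p.2).
    rewrite -mulrBr normrM distrC.
    apply: (@le_trans _ _ ((K * N s phi0) *
       (C2 * expR (- L * t) * \prod_(p <- l) N s p.2))); last by apply: ler_eq; ring.
    rewrite ler_pM ?meanK//; apply: (le_trans e2).
    by rewrite ler_wpM2r ?NP0// ler_wpM2l// expL// lerDr.
  apply: (le_trans (ler_distD ((\int[mu]_x phi0 x) * \prod_(p <- l) \int[mu]_x p.2 x) _ _)).
  apply: (le_trans (lerD e1 e2)); rewrite -!mulrDl.
  rewrite ler_wpM2r ?mulr_ge0 ?NP0// ler_wpM2r ?expR_ge0// lerDl.
  by rewrite !mulr_ge0 ?exprn_ge0.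
- rewrite -ltNge => close; have [|l1 [l2 [l3 El]]] := @split_two _ x0 l i j.
    by rewrite sl.
  move: close El; case: (nth x0 l i) (nth x0 l j) => [g f1] [h f2] /= close El.
  (* The merged factor is placed at [g], a point of [l], so it is still far from [g0]. *)
  pose f12 x := f1 x * tr (mul (inv g) h) f2 x.
  pose l' := (g, f12) :: l1 ++ l2 ++ l3.
  have A1 : A f1 by apply: (Al (g, f1)); rewrite El !(mem_cat, inE) eqxx !orbT.
  have A2 : A f2 by apply: (Al (h, f2)); rewrite El !(mem_cat, inE) eqxx !orbT.
  have A12 : A f12 by apply: algebra_mul => //; exact: algebra_translate.
  have sub p : p \in l1 ++ l2 ++ l3 -> p \in l.
    by rewrite El !(mem_cat, inE) => /or3P[]->; rewrite ?orbT.
  have Al' p : p \in l' -> A p.2 by rewrite inE => /predU1P[->//|/sub/Al].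
  have sl' : size l' = k.
    by apply/eqP; rewrite -eqSS -sl El /l' /= !size_cat/= !size_cat/= !addnS.
  have tprodE x : tprod l x = tprod l' x.
    have trE : tr g f12 x = tr g f1 x * tr h f2 x.
      by rewrite -(translate_factor groupH actH g h).
    by rewrite /tprod El /l' !(big_cat, big_cons)/= trE; ring.
  have NlE : \prod_(p <- l) N s p.2 =
      N s f1 * N s f2 * \prod_(p <- l1 ++ l2 ++ l3) N s p.2.
    by rewrite El !(big_cat, big_cons)/=; ring.
  have far' p : p \in l' -> b2 * t <= d g0 p.1.
    move=> pl'; apply: (@le_trans _ _ ((b1 + b2) * t)).
      by rewrite ler_wpM2r// lerDr.
    move: pl'; rewrite inE => /predU1P[->/=|/sub/far//].
    by apply: (far (g, f1)); rewrite El !(mem_cat, inE) eqxx !orbT.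
  under eq_Rintegral do rewrite tprodE.
  under [X in _ - _ * X]eq_Rintegral do rewrite tprodE.
  apply: (le_trans (dec t g0 phi0 l' t0 sl' A0 Al' far')).
  apply: (@le_trans _ _ (C6 * (C5 * (Cm * C3 * C3) * C4 ^+ k.-1) * expR (- L * t) *
      (N s phi0 * \prod_(p <- l) N s p.2))); last first.
    rewrite ler_wpM2r ?mulr_ge0 ?NP0// ler_wpM2r ?expR_ge0// lerDr.
    by rewrite addr_ge0 ?mulr_ge0.
  have N10 := seminorm_ge0 s0 A1; have N20 := seminorm_ge0 s0 A2.
  have NR0 := NP0 _ (fun p pl => Al _ (sub p pl)).
  have N12 : N s1 f12 <= Cm * expR (sg * b1 * t) * (C3 * N s f1) * (C3 * N s f2).
    apply: (le_trans (merge g h f1 f2 A1 A2)).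
    have N1 := seminorm_ge0 (ltn0Sn s1) A1; have N2 := seminorm_ge0 (ltn0Sn s1) A2.
    rewrite ler_pM ?mono ?mulr_ge0 ?expR_ge0// ler_pM ?mono ?mulr_ge0 ?expR_ge0//.
    by rewrite ler_wpM2l// ler_expR -mulrA ler_wpM2l// ltW.
  have -> : - (L + sg * b1) * t = - L * t - sg * b1 * t by ring.
  rewrite expRD expRN NlE big_cons/=.
  have E0 := expR_gt0 (sg * b1 * t); set E := expR (sg * b1 * t) in E0 N12 *.
  set Q := \prod_(p <- l1 ++ l2 ++ l3) N s1 p.2.
  set Q' := \prod_(p <- l1 ++ l2 ++ l3) N s p.2 in NR0 *.
  have QQ' : Q <= C4 ^+ k.-1 * Q'.
    rewrite -sl' /=; apply: monop => p /sub; exact: Al.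
  have Q0 : 0 <= Q.
    by rewrite /Q big_seq; apply: prodr_ge0 => p /sub/Al; exact: seminorm_ge0.
  apply: (@le_trans _ _ (C6 * (expR (- L * t) / E) * ((C5 * N s phi0) *
      ((Cm * E * (C3 * N s f1) * (C3 * N s f2)) * (C4 ^+ k.-1 * Q'))))).
    have E0' := ltW E0.
    rewrite ler_wpM2l ?mulr_ge0 ?expR_ge0 ?invr_ge0//.
    have n1 := seminorm_ge0 s10 A0; have n2 := seminorm_ge0 s10 A12.
    by apply: ler_pM; rewrite ?mono1 ?mulr_ge0//; apply: ler_pM.
  by apply: ler_eq; field; rewrite gt_eqF.
Qed.

End decorrelation.

(** * Borel measurability on the group *)

Section borel_group.
Context {R : realType} {H : pseudoPMetricType R}.
Variables (mul : H -> H -> H) (inv : H -> H) (e : H) (d : H -> H -> R).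
Hypothesis groupH : lcsc_group_with_left_invariant_metric mul inv e d.
Local Notation BH := (borel_of H).

Lemma open_measurable_borel (U : set H) : open U -> measurable (U : set BH).
Proof. by move=> oU; exact: sub_sigma_algebra. Qed.

Lemma measurable_inv : measurable_fun [set: BH] (inv : BH -> BH).
Proof.
apply: (@measurability _ _ BH BH setT inv (@open H)) => //.
move=> _ [U oU <-]; rewrite setTI; apply: open_measurable_borel.
by move: oU; apply: (continuousP _).1; case: groupH => _ [].
Qed.

Lemma nbhs_dball g (eps : R) : 0 < eps -> nbhs g (dball d g eps).
Proof.
move=> eps0; apply/nbhs_ballP; exists eps => //=.
by case: groupH => _ _ _ [_ _ _ _ dE] _; rewrite dE.
Qed.

Lemma open_dball g (rho : R) : open (dball d g rho).
Proof.
rewrite openE => h /= gh.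
have r0 : 0 < rho - d g h by rewrite subr_gt0.
apply: filterS (nbhs_dball h r0) => k /= hk.
by rewrite /dball/= (le_lt_trans (dist_triangle groupH g h k))// -ltrBrDl.
Qed.

Lemma measurable_dball g (rho : R) : measurable (dball d g rho : set BH).
Proof. by apply: open_measurable_borel; exact: open_dball. Qed.

(* Second countability is needed to write the open set [d g h < rho] as a
   countable union of rectangles, i.e. to place it in the product sigma-algebra. *)
Lemma measurable_dist_lt (rho : R) :
  measurable [set p : BH * BH | d p.1 p.2 < rho].
Proof.
have [B /countable_injP[F Finj] [Bopen Bbasis]] : @second_countable H by case: groupH => _ _ [].
(* Rectangles of basic open sets on which the distance stays below [rho]. A point is enclosed in one
   by giving each coordinate half of the slack [rho - d g h]. *)
pose ok (p : set H * set H) :=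
  [/\ B p.1, B p.2 & forall g h, p.1 g -> p.2 h -> d g h < rho].
have -> : [set p : BH * BH | d p.1 p.2 < rho] = \bigcup_(i : nat * nat)
    [set p | exists q, [/\ ok q, (F q.1, F q.2) = i & q.1 p.1 /\ q.2 p.2]].
  apply/seteqP; split=> [[g h]/= gh|[g h] [i _ [q [[_ _ qd] _ [qg qh]]]]]; last exact: qd.
  have r0 : 0 < (rho - d g h) / 2 by rewrite divr_gt0// subr_gt0.
  have [U [BU Ug] Usub] := Bbasis g _ (nbhs_dball g r0).
  have [V [BV Vh] Vsub] := Bbasis h _ (nbhs_dball h r0).
  exists (F U, F V) => //=; exists (U, V); split=> //; split=> // g' h' Ug' Vh'.
  have := Usub _ Ug'; have := Vsub _ Vh'; rewrite /dball/= => hh' gg'.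
  have t1 := dist_triangle groupH g' g h'; have t2 := dist_triangle groupH g h h'.
  rewrite (dist_sym groupH g' g) in t1; lra.
(* [F] is injective on the basis, so the piece of index [i] is a single rectangle or empty. *)
apply: countable_bigcupT_measurable => // i.
have [[q [okq qi]]|none] := pselect (exists q, ok q /\ (F q.1, F q.2) = i).
  rewrite [X in measurable X](_ : _ = q.1 `*` q.2).
    by case: okq => B1 B2 _; apply: measurableX; apply: open_measurable_borel; exact: Bopen.
  apply/seteqP; split=> [[g h] [q' [okq' q'i [/= ? ?]]]|[g h] [/= ? ?]]; last by exists q.
  move: q'i; rewrite -qi => -[e1 e2]; case: okq' okq => B1' B2' _ [B1 B2 _].
  rewrite -(Finj q'.1 q.1) ?inE// -(Finj q'.2 q.2) ?inE//.
rewrite [X in measurable X](_ : _ = set0)//.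
by apply/seteqP; split=> // p [q [okq qi _]]; apply: none; exists q.
Qed.

Variable nu : {finite_measure set BH -> \bar R}.

(** The ball mass is a partial integral of the indicator of {d < rho}, so its measurability in [h]
    is part of Fubini. *)
Lemma bounded_mfun_ball_mass (rho : R) :
  bounded_mfun (fun h : BH => fine (nu (dball d h rho))).
Proof.
pose K (p : BH * BH) : R := \1_[set p : BH * BH | d p.1 p.2 < rho] p.
have bK : bounded_mfun K.
  split; first by apply: measurable_indic; exact: measurable_dist_lt.
  by exists 1 => p; rewrite /K indicE; case: (_ \in _); rewrite ?normr1 ?normr0.
have := bounded_mfun_Rintegral1 nu nu bK; congr bounded_mfun.
apply/funext => h; congr fine; rewrite -[X in _ = nu X]setIT.
rewrite -integral_indic//; last exact: measurable_dball.
Qed.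

End borel_group.

(** * Correlations of a single function *)

Section power_inequalities.
Context {R : realType}.
Implicit Types a b x y : R.

Lemma exprD_le m x y : 0 <= x -> 0 <= y ->
  (x + y) ^+ m <= 2 ^+ m * (x ^+ m + y ^+ m).
Proof.
wlog xy : x y / x <= y => [wl x0 y0|x0 y0].
  by have [/wl->//|/ltW /wl] := leP x y; rewrite addrC [y ^+ m + _]addrC; exact.
apply: (@le_trans _ _ ((2 * y) ^+ m)).
  by rewrite lerXn2r ?nnegrE ?addr_ge0 ?mulr_ge0//; lra.
by rewrite exprMn ler_wpM2l ?exprn_ge0// lerDr exprn_ge0.
Qed.

Lemma exprD_first_order m a b :
  `|(a + b) ^+ m.+1 - a ^+ m.+1| <= m.+1%:R * `|b| * (`|a| + `|b|) ^+ m.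
Proof.
have S0 : 0 <= `|a| + `|b| by rewrite addr_ge0.
elim: m => [|m IH]; first by rewrite !expr1 expr0 mulr1 mul1r addrAC subrr add0r.
have -> : (a + b) ^+ m.+2 - a ^+ m.+2 =
    (a + b) * ((a + b) ^+ m.+1 - a ^+ m.+1) + b * a ^+ m.+1.
  by rewrite !exprS; ring.
apply: (le_trans (ler_normD _ _)); rewrite !normrM normrX.
have h1 : `|a + b| * `|(a + b) ^+ m.+1 - a ^+ m.+1| <=
    (`|a| + `|b|) * (m.+1%:R * `|b| * (`|a| + `|b|) ^+ m).
  by rewrite ler_pM// ler_normD.
have h2 : `|b| * `|a| ^+ m.+1 <= `|b| * (`|a| + `|b|) ^+ m.+1.
  by rewrite ler_wpM2l// lerXn2r ?nnegrE// lerDl.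
apply: (le_trans (lerD h1 h2)); apply: ler_eq.
by rewrite -[m.+2%:R]natr1 exprS; ring.
Qed.

(** The remainder of the next order is (a + b) times the present one plus a term in b^2. The
    constant is not sharp; it closes the induction because (m+2)^2 + (m+2) <= (m+3)^2. *)
Lemma exprD_second_order m a b :
  `|(a + b) ^+ m.+2 - a ^+ m.+2 - m.+2%:R * b * a ^+ m.+1|
    <= m.+2%:R ^+ 2 * b ^+ 2 * (`|a| + `|b|) ^+ m.
Proof.
have S0 : 0 <= `|a| + `|b| by rewrite addr_ge0.
elim: m => [|m IH].
  have -> : (a + b) ^+ 2 - a ^+ 2 - 2%:R * b * a ^+ 1 = b ^+ 2 by ring.
  rewrite expr0 mulr1 normrX real_normK ?num_real// ler_peMl ?sqr_ge0//.
  by rewrite -natrX ler1n.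
have -> : (a + b) ^+ m.+3 - a ^+ m.+3 - m.+3%:R * b * a ^+ m.+2 =
    (a + b) * ((a + b) ^+ m.+2 - a ^+ m.+2 - m.+2%:R * b * a ^+ m.+1)
    + m.+2%:R * b ^+ 2 * a ^+ m.+1.
  by rewrite -[m.+3%:R]natr1 !exprS; ring.
apply: (le_trans (ler_normD _ _)); rewrite normrM.
have h1 : `|a + b| * `|(a + b) ^+ m.+2 - a ^+ m.+2 - m.+2%:R * b * a ^+ m.+1| <=
    (`|a| + `|b|) * (m.+2%:R ^+ 2 * b ^+ 2 * (`|a| + `|b|) ^+ m).
  by rewrite ler_pM// ler_normD.
have h2 : `|m.+2%:R * b ^+ 2 * a ^+ m.+1| <=
    m.+2%:R * b ^+ 2 * (`|a| + `|b|) ^+ m.+1.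
  have b2 : 0 <= m.+2%:R * b ^+ 2 by rewrite mulr_ge0// sqr_ge0.
  rewrite normrM [`|a ^+ _|]normrX ger0_norm//.
  by rewrite ler_wpM2l// lerXn2r ?nnegrE// lerDl.
apply: (le_trans (lerD h1 h2)).
have -> : (`|a| + `|b|) * (m.+2%:R ^+ 2 * b ^+ 2 * (`|a| + `|b|) ^+ m) =
    m.+2%:R ^+ 2 * b ^+ 2 * (`|a| + `|b|) ^+ m.+1 by rewrite [(_ + _) ^+ m.+1]exprS; ring.
rewrite -!mulrDl ler_wpM2r ?exprn_ge0// ler_wpM2r ?sqr_ge0//.
by rewrite -!natrX -!natrD ler_nat; lia.
Qed.

End power_inequalities.

Section correlations.
Context {R : realType} {H : pseudoPMetricType R}.
Variables (mul : H -> H -> H) (inv : H -> H) (e : H) (d : H -> H -> R).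
Context {dX : measure_display} {X : measurableType dX}.
Variables (mu : probability X R) (act : H -> X -> X).
Variables (A : set (X -> R)) (N : nat -> (X -> R) -> R).
Hypothesis groupH : lcsc_group_with_left_invariant_metric mul inv e d.
Hypothesis actH : mp_action mul e mu act.
Hypothesis algA : invariant_subalgebra mu inv act A.
Hypothesis semiN : admissible_seminorms mu inv e d act A N.
Hypothesis mixing : exp_mixing_all_orders mu inv d act A N.
Variables (f : X -> R) (M : R).
Hypotheses (Af : A f) (mean0 : \int[mu]_x f x = 0).
Hypotheses (M0 : 0 <= M) (fM : {ae mu, forall x, `|f x| <= M}).
Implicit Types (g h : H) (hs : seq H).
Local Notation tr := (translate inv act).
Local Notation k h x := (tr h (clip M f) x).
Local Notation pk hs x := (\prod_(h <- hs) k h x).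

Lemma bounded_mfun_tclip h : bounded_mfun (fun x => k h x).
Proof.
apply: (bounded_mfun_translate inv actH); apply: bounded_mfun_clip => //.
exact: (algebra_measurable algA).
Qed.

Lemma bounded_mfun_pclip hs : bounded_mfun (fun x => pk hs x).
Proof. by apply: bounded_mfun_prod => h; exact: bounded_mfun_tclip. Qed.

(** The bridge from the truncated products, which are integrated, to products of elements of [A],
    for which mixing is available. *)
Lemma mean_pclip hs : \int[mu]_x pk hs x = \int[mu]_x \prod_(h <- hs) tr h f x.
Proof.
apply: ae_eq_mean.
- by case: (bounded_mfun_pclip hs).
- elim: hs => [|h hs IH].
    by under eq_fun do rewrite big_nil; exact: measurable_cst.
  under eq_fun do rewrite big_cons; apply: measurable_funM => //.
  exact/(measurable_translate inv actH)/(algebra_measurable algA).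
- elim: hs => [|h hs IH]; first by apply/aeW => x; rewrite !big_nil.
  apply: filterS2 IH (ae_act actH (inv h) fM) => x IH /clip_id E.
  by rewrite !big_cons IH [in LHS]/translate E.
Qed.

Let tprodE hs x : tprod inv act [seq (h, f) | h <- hs] x = \prod_(h <- hs) tr h f x.
Proof. by rewrite /tprod big_map. Qed.

(** [decorrelation] with [f] at the isolated point: mean zero removes the product of means. *)
Lemma isolated_correlation (m : nat) (L : R) : 0 <= L ->
  exists2 b : R, 0 <= b & exists2 C : R, 0 <= C &
  forall (t : R) g0 hs, 0 <= t -> size hs = m ->
  (forall h, h \in hs -> b * t <= d g0 h) ->
  `|\int[mu]_x (k g0 x * pk hs x)| <= C * expR (- L * t).
Proof.
move=> L0; have [s s0 /(_ L L0)[b b0 [C C0 dec]]] :=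
  decorrelation groupH actH algA semiN mixing m.
have N0 := seminorm_ge0 semiN s0 Af.
exists b => //; exists (C * (N s f * N s f ^+ m)); first by rewrite !mulr_ge0 ?exprn_ge0.
move=> t g0 hs t0 shs far.
have := dec t g0 f [seq (h, f) | h <- hs] t0; rewrite size_map => /(_ shs Af).
rewrite mean0 mul0r subr0 big_map/= big_const_seq count_predT shs iter_mulr_1.
have -> : \int[mu]_x (tr g0 f x * tprod inv act [seq (h, f) | h <- hs] x) =
    \int[mu]_x (k g0 x * pk hs x).
  have := mean_pclip (g0 :: hs); under eq_Rintegral do rewrite big_cons.
  by move=> ->; apply: eq_Rintegral => x _; rewrite tprodE big_cons.
move=> /(_ _ _)/le_trans; apply.
- by move=> p /mapP[h _ ->].
- by move=> p /mapP[h hhs ->]; exact: far.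
- by apply: ler_eq; ring.
Qed.

(* If [g] is close to [g0], the pair forms a cluster which is far from [hs];
   otherwise [g0] is isolated and both correlations are small. *)
Lemma pair_correlation (m : nat) (L : R) : 0 <= L ->
  exists2 b : R, 0 <= b & exists2 C : R, 0 <= C &
  forall (t : R) g0 g hs, 0 <= t -> size hs = m ->
  (forall h, h \in hs -> b * t <= d g0 h) ->
  `|\int[mu]_x (k g0 x * k g x * pk hs x)
    - (\int[mu]_x (k g0 x * k g x)) * \int[mu]_x pk hs x| <= C * expR (- L * t).
Proof.
move=> L0.
have [b1 b10 [C1 C10 iso1]] := isolated_correlation 1 L0.
have [b2 b20 [C2 C20 iso2]] := isolated_correlation m.+1 L0.
have [s s0 dec0] := decorrelation groupH actH algA semiN mixing m.
have [sg sg0 [Cm Cm0 merge]] := seminorm_merge groupH algA semiN s0.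
(* Beyond [a * t] the point [g] is far enough for both isolation estimates, that of [g0] against [g]
   alone and that of [g0] against [g :: hs]. *)
pose a := b1 + b2; have a0 : 0 <= a by rewrite addr_ge0.
(* The extra exponent absorbs the seminorm of the merged pair, of size exp(sg a t) when [g] is
   close. *)
have [b3 b30 [C3 C30 dec]] := dec0 _ (addr_ge0 L0 (mulr_ge0 sg0 a0)).
have N0 := seminorm_ge0 semiN s0 Af; have N1 := seminorm_ge0 semiN (ltn0Sn s) Af.
have bpk := bounded_mfun_pclip.
exists (a + b3); first by rewrite addr_ge0.
exists (C1 * M ^+ m + C2 + C3 * (Cm * N s.+1 f * N s.+1 f * N s f ^+ m)).
  by rewrite !addr_ge0 ?mulr_ge0 ?exprn_ge0.
move=> t g0 g hs t0 shs far.
have pM : `|\int[mu]_x pk hs x| <= M ^+ m.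
  apply: norm_mean_le_cst => // x; rewrite -shs.
  elim: (hs) => [|h l IH]; first by rewrite big_nil normr1.
  by rewrite big_cons normrM exprS ler_pM// norm_clip_le.
have [close|apart] := ltP (d g0 g) (a * t); last first.
- have e1 := iso1 t g0 [:: g] t0 erefl.
  have {}e1 : `|\int[mu]_x (k g0 x * k g x)| <= C1 * expR (- L * t).
    move: e1; under eq_Rintegral do rewrite big_seq1.
    apply=> h; rewrite inE => /eqP ->; apply: le_trans apart.
    by rewrite ler_wpM2r// lerDl.
  have e2 := iso2 t g0 (g :: hs) t0.
  have {}e2 : `|\int[mu]_x (k g0 x * k g x * pk hs x)| <= C2 * expR (- L * t).
    move: e2; under eq_Rintegral do rewrite big_cons mulrA.
    apply; first by rewrite /= shs.
    move=> h; rewrite inE => /predU1P[->|/far]; last apply: le_trans.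
      by apply: le_trans apart; rewrite ler_wpM2r// lerDr.
    by rewrite ler_wpM2r// /a; lra.
  apply: (le_trans (ler_normB _ _)); rewrite normrM.
  apply: (@le_trans _ _ (C2 * expR (- L * t) + C1 * expR (- L * t) * M ^+ m)).
    by rewrite lerD// ler_pM.
  rewrite !mulrDl addrC -addrA mulrAC lerD2l lerDl.
  by rewrite !mulr_ge0 ?exprn_ge0 ?expR_ge0.
- pose f2 x := f x * tr (mul (inv g0) g) f x.
  have A2 : A f2 by apply: (algebra_mul algA) => //; exact: (algebra_translate algA).
  have f2E x : tr g0 f2 x = tr g0 f x * tr g f x.
    by rewrite -(translate_factor groupH actH g0 g).
  have := dec t g0 f2 [seq (h, f) | h <- hs] t0; rewrite size_map => /(_ shs A2).
  rewrite big_map/= big_const_seq count_predT shs iter_mulr_1.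
  have -> : \int[mu]_x (tr g0 f2 x * tprod inv act [seq (h, f) | h <- hs] x) =
      \int[mu]_x (k g0 x * k g x * pk hs x).
    have := mean_pclip [:: g0, g & hs]; under eq_Rintegral do rewrite 2!big_cons mulrA.
    move=> ->; apply: eq_Rintegral => x _.
    by rewrite tprodE 2!big_cons mulrA f2E.
  have -> : \int[mu]_x tprod inv act [seq (h, f) | h <- hs] x = \int[mu]_x pk hs x.
    by rewrite mean_pclip; apply: eq_Rintegral => x _; rewrite tprodE.
  have -> : \int[mu]_x f2 x = \int[mu]_x (k g0 x * k g x).
    rewrite -(algebra_mean_translate actH algA g0 A2).
    have := mean_pclip [:: g0; g]; under eq_Rintegral do rewrite 2!big_cons big_nil mulr1.
    move=> ->; apply: eq_Rintegral => x _.
    by rewrite 2!big_cons big_nil mulr1 f2E.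
  move=> /(_ _ _)/le_trans; apply.
  + by move=> p /mapP[h _ ->].
  + move=> p /mapP[h hhs ->]; apply: le_trans (far _ hhs).
    by rewrite ler_wpM2r// lerDr.
  have m2 := merge g0 g f f Af Af.
  apply: (@le_trans _ _ (C3 * expR (- (L + sg * a) * t) *
     ((Cm * expR (sg * a * t) * N s.+1 f * N s.+1 f) * N s f ^+ m))).
    rewrite ler_wpM2l ?mulr_ge0 ?expR_ge0// ler_wpM2r ?exprn_ge0//.
    apply: (le_trans m2); rewrite ler_wpM2r// ler_wpM2r// ler_wpM2l//.
    by rewrite ler_expR -mulrA ler_wpM2l// ltW.
  have -> : - (L + sg * a) * t = - L * t - sg * a * t by ring.
  rewrite expRD expRN.
  have E0 := expR_gt0 (sg * a * t).
  apply: (@le_trans _ _ (C3 * (Cm * N s.+1 f * N s.+1 f * N s f ^+ m) * expR (- L * t))).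
    by apply: ler_eq; field; rewrite gt_eqF.
  by rewrite ler_wpM2r ?expR_ge0// lerDr addr_ge0 ?mulr_ge0 ?exprn_ge0.
Qed.

End correlations.

(** * The moment recursion *)

Section moment_recursion.
Context {R : realType} {H : pseudoPMetricType R}.
Variables (mul : H -> H -> H) (inv : H -> H) (e : H) (d : H -> H -> R).
Context {dX : measure_display} {X : measurableType dX}.
Variables (mu : probability X R) (act : H -> X -> X).
Variables (A : set (X -> R)) (N : nat -> (X -> R) -> R).
Hypothesis groupH : lcsc_group_with_left_invariant_metric mul inv e d.
Hypothesis actH : mp_action mul e mu act.
Hypothesis algA : invariant_subalgebra mu inv act A.
Hypothesis semiN : admissible_seminorms mu inv e d act A N.
Hypothesis mixing : exp_mixing_all_orders mu inv d act A N.
Variables (f : X -> R) (M : R).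
Hypotheses (Af : A f) (mean0 : \int[mu]_x f x = 0).
Hypotheses (M0 : 0 <= M) (fM : {ae mu, forall x, `|f x| <= M}).
Local Notation BH := (borel_of H).
Implicit Types (g h : H) (hs : seq H) (D : set BH) (G : X -> R)
  (nu : {finite_measure set BH -> \bar R}).
Local Notation tr := (translate inv act).
Local Notation k h x := (tr h (clip M f) x).
Local Notation pk hs x := (\prod_(h <- hs) k h x).
Let bk h : bounded_mfun (fun x => k h x) := bounded_mfun_tclip actH algA Af M0 h.
Let bpk hs : bounded_mfun (fun x => pk hs x) := bounded_mfun_pclip actH algA Af M0 hs.

Lemma measurable_joint_translate (f' : X -> R) : measurable_fun setT f' ->
  measurable_fun setT (fun p : BH * X => tr p.1 f' p.2).
Proof.
move=> mf; have mact : measurable_fun setT (fun p : BH * X => act p.1 p.2).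
  by case: actH.
have minv : measurable_fun setT (fun p : BH * X => (inv p.1, p.2) : BH * X).
  apply: measurable_fun_pair => //=.
  exact: (measurableT_comp (measurable_inv groupH) measurable_fst).
exact: (measurableT_comp mf (measurableT_comp mact minv)).
Qed.

Let bkk : bounded_mfun (fun p : BH * X => k p.1 p.2).
Proof.
have mf := algebra_measurable algA Af.
split; first by apply: measurable_joint_translate; case: (bounded_mfun_clip M0 mf).
by exists M => p; exact: norm_clip_le.
Qed.

(** With [D] the whole group this is the truncated version of nu * f; a ball and its complement give
    the near and far parts. *)
Definition cpart nu D x : R := \int[nu]_(h in D) k h x.

Lemma bounded_mfun_cpart nu D : measurable D -> bounded_mfun (cpart nu D).
Proof. by move=> mD; exact: (bounded_mfun_section_Rintegral nu mu bkk mD). Qed.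

Lemma mean_cpart nu D G : measurable D -> bounded_mfun G ->
  \int[mu]_x (G x * cpart nu D x) = \int[nu]_(h in D) \int[mu]_x (G x * k h x).
Proof. by move=> mD bG; exact: (RFubini_weighted nu mu bkk mD bG). Qed.

Lemma bounded_mfun_mean_k G : bounded_mfun G ->
  bounded_mfun (fun h : BH => \int[mu]_x (G x * k h x)).
Proof.
move=> bG.
have bGk : bounded_mfun (fun p : BH * X => G p.2 * k p.1 p.2).
  by apply: bounded_mfunM => //; exact: bounded_mfun_snd.
(* A Dirac mass serves as the finite measure on the group that the Fubini lemma takes as an
   argument. *)
exact: (bounded_mfun_Rintegral1 (dirac point) mu bGk).
Qed.

Lemma norm_cpart_le nu D x : measurable D -> `|cpart nu D x| <= M * fine (nu D).
Proof.
move=> mD; apply: normr_Rintegral_bounded => //.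
  exact: (bounded_mfun_pair2 x bkk).
by move=> h _; exact: norm_clip_le.
Qed.

Lemma cpart_split nu D x : measurable D ->
  cpart nu setT x = cpart nu (~` D) x + cpart nu D x.
Proof.
move=> mD; rewrite /cpart -[in LHS](setvU D) Rintegral_setU//.
- exact: measurableC.
- rewrite setvU; apply: bounded_mfun_integrable => //.
  exact: (bounded_mfun_pair2 x bkk).
- by apply/disj_set2P; rewrite setICl.
Qed.

Lemma fine_measure_le nu D : measurable D -> fine (nu D) <= fine (nu setT).
Proof.
by move=> mD; rewrite fine_le ?fin_num_measure// le_measure ?inE.
Qed.

(** The power is an iterated integral over m points of [D]. One integral is peeled off at a time and
    its integrand joins [G], so a bound uniform in the points is multiplied by the mass m times. *)
Lemma mean_cpart_exp_le nu D G (eta : R) (m : nat) : measurable D ->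
  bounded_mfun G -> 0 <= eta ->
  (forall hs, size hs = m -> (forall h, h \in hs -> D h) ->
    `|\int[mu]_x (G x * pk hs x)| <= eta) ->
  `|\int[mu]_x (G x * cpart nu D x ^+ m)| <= eta * fine (nu setT) ^+ m.
Proof.
move=> mD + eta0; elim: m G => [|m IH] G bG GD.
  rewrite expr0 mulr1; have := GD [::] erefl; under eq_Rintegral do rewrite big_nil.
  by under [X in _ -> `|X| <= _]eq_Rintegral do rewrite expr0; apply.
have bc := bounded_mfun_cpart nu mD.
under eq_Rintegral do rewrite exprSr mulrA.
rewrite mean_cpart//; last by apply: bounded_mfunM => //; exact: bounded_mfunX.
apply: (@le_trans _ _ (eta * fine (nu setT) ^+ m * fine (nu D))); last first.
  rewrite exprSr mulrA ler_wpM2l ?fine_measure_le//.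
  by rewrite mulr_ge0 ?exprn_ge0 ?fine_ge0.
apply: normr_Rintegral_bounded => //.
  by apply: bounded_mfun_mean_k; apply: bounded_mfunM => //; exact: bounded_mfunX.
move=> h Dh; under eq_Rintegral do rewrite mulrAC.
apply: IH; first exact: bounded_mfunM.
move=> hs shs hsD; have := GD (h :: hs); under eq_Rintegral do rewrite big_cons mulrA.
by apply=> [|g]; [rewrite /= shs|rewrite inE => /predU1P[->//|/hsD]].
Qed.

(** * The integrand of the recursion at one group element *)

Section near_far.
Variables (nu : {finite_measure set BH -> \bar R}) (m : nat) (b C L : R).
Let n := fine (nu setT).
Let t := ln n.
Hypotheses (n1 : 1 <= n) (C0 : 0 <= C).
Let eta := C * expR (- L * t).
Let t0 : 0 <= t. Proof. by rewrite ln_ge0. Qed.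
Let eta0 : 0 <= eta. Proof. by rewrite mulr_ge0 ?expR_ge0. Qed.
Hypothesis iso1 : forall g0 g, b * t <= d g0 g ->
  `|\int[mu]_x (k g0 x * k g x)| <= eta.
Hypothesis iso : forall g0 hs, size hs = m.+2 ->
  (forall h, h \in hs -> b * t <= d g0 h) ->
  `|\int[mu]_x (k g0 x * pk hs x)| <= eta.
Hypothesis pair : forall g0 g hs, size hs = m.+1 ->
  (forall h, h \in hs -> b * t <= d g0 h) ->
  `|\int[mu]_x (k g0 x * k g x * pk hs x)
    - (\int[mu]_x (k g0 x * k g x)) * \int[mu]_x pk hs x| <= eta.

Let B h : set BH := dball d h (b * t).
Let mB h : measurable (B h). Proof. exact: (measurable_dball groupH). Qed.
Let mBc h : measurable (~` B h). Proof. exact/measurableC. Qed.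
Let farP h g : (~` B h) g -> b * t <= d h g.
Proof. by rewrite /B /dball/= => /negP; rewrite -leNgt. Qed.
Let F := cpart nu setT.
Let near h := cpart nu (B h).
Let far h := cpart nu (~` B h).
Let u h := fine (nu (B h)).
Let bF : bounded_mfun F. Proof. exact: bounded_mfun_cpart. Qed.
Let bnear h : bounded_mfun (near h). Proof. exact: bounded_mfun_cpart. Qed.
Let bfar h : bounded_mfun (far h). Proof. exact: bounded_mfun_cpart. Qed.
Let Fsplit h x : F x = far h x + near h x. Proof. exact: cpart_split. Qed.
Let u0 h : 0 <= u h. Proof. exact: fine_ge0. Qed.

Let far_isolated h : `|\int[mu]_x (k h x * far h x ^+ m.+2)| <= eta * n ^+ m.+2.
Proof.
by apply: mean_cpart_exp_le => // hs shs hsD; apply: iso => // g /hsD/farP.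
Qed.

Let far1_isolated h : `|\int[mu]_x (k h x * far h x)| <= eta * n.
Proof.
have := @mean_cpart_exp_le nu (~` B h) (fun x => k h x) eta 1.
under eq_Rintegral do rewrite expr1.
rewrite expr1; apply=> // -[|g [|//]]//= _ hsD.
under eq_Rintegral do rewrite big_seq1.
by apply/iso1/farP/hsD; rewrite mem_head.
Qed.

(** Centring [k h * near h] at its mean [c] turns the difference into a single integral against a
    power of [far h]. For fixed far points, that integral is an average over [g] in the ball of the
    differences bounded by [pair]. *)
Let near_far_decorrelated h :
  `|\int[mu]_x (k h x * near h x * far h x ^+ m.+1)
    - (\int[mu]_x (k h x * near h x)) * \int[mu]_x (far h x ^+ m.+1)|
  <= eta * n ^+ m.+2.
Proof.
set c := \int[mu]_x (k h x * near h x).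
have bkn : bounded_mfun (fun x => k h x * near h x) by exact: bounded_mfunM.
have cntr G : bounded_mfun G -> \int[mu]_x (k h x * near h x * G x) - c * \int[mu]_x G x =
    \int[mu]_x ((k h x * near h x - c) * G x).
  move=> bG; rewrite -meanZ// -meanB//.
  - by apply: eq_Rintegral => x _; rewrite mulrBl.
  - exact: bounded_mfunM.
  - exact: bounded_mfunZ.
rewrite cntr; last exact: bounded_mfunX.
(* One factor [n] is kept for the mass of the ball over which [near] is integrated; the other m+1
   come from the power of [far]. *)
rewrite exprS mulrA; apply: mean_cpart_exp_le => //.
- by apply: bounded_mfunB => //; exact: bounded_mfun_cst.
- by rewrite mulr_ge0// (le_trans _ n1).
move=> hs shs hsD; rewrite -cntr// /c.
have bkp : bounded_mfun (fun x => k h x * pk hs x) by exact: bounded_mfunM.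
have -> : \int[mu]_x (k h x * near h x * pk hs x) =
    \int[nu]_(g in B h) \int[mu]_x (k h x * pk hs x * k g x).
  by rewrite -mean_cpart//; apply: eq_Rintegral => x _; rewrite mulrAC.
rewrite mean_cpart// -RintegralZr//; last first.
  by apply: bounded_mfun_integrable => //; exact: bounded_mfun_mean_k.
rewrite -RintegralB//; last 2 first.
- by apply: bounded_mfun_integrable => //; exact: bounded_mfun_mean_k.
- apply: bounded_mfun_integrable => //; apply: bounded_mfunM.
    exact: bounded_mfun_mean_k.
  exact: bounded_mfun_cst.
apply: (@le_trans _ _ (eta * fine (nu (B h)))); last first.
  by rewrite ler_wpM2l// fine_measure_le.
apply: normr_Rintegral_bounded => //.
  apply: bounded_mfunB; first exact: bounded_mfun_mean_k.
  by apply: bounded_mfunM; [exact: bounded_mfun_mean_k|exact: bounded_mfun_cst].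
move=> g _; under eq_Rintegral do rewrite mulrAC.
by apply: pair => // g' /hsD/farP.
Qed.

Let a := \int[mu]_x (`|F x| ^+ m).

(** Since far = F - near, the sum is at most |F| + 2 M u; this leads back to a moment of [F],
    independent of [h]. *)
Let S_le h : \int[mu]_x ((`|far h x| + `|near h x|) ^+ m) <=
  2 ^+ m * (a + (2 * M * u h) ^+ m).
Proof.
have bF' : bounded_mfun (fun x => `|F x| ^+ m).
  by apply: bounded_mfunX; exact: bounded_mfun_norm.
rewrite -(mean_cst mu ((2 * M * u h) ^+ m)) -meanD//; last exact: bounded_mfun_cst.
rewrite -meanZ; last by apply: bounded_mfunD => //; exact: bounded_mfun_cst.
apply: le_mean.
- by apply: bounded_mfunX; apply: bounded_mfunD; exact: bounded_mfun_norm.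
- by apply: bounded_mfunZ; apply: bounded_mfunD => //; exact: bounded_mfun_cst.
move=> x; apply: (@le_trans _ _ ((`|F x| + 2 * M * u h) ^+ m)).
  have nM := norm_cpart_le nu x (mB h).
  rewrite lerXn2r ?nnegrE ?addr_ge0 ?mulr_ge0//.
  have -> : far h x = F x - near h x by rewrite (Fsplit h) addrK.
  have := ler_normB (F x) (near h x); rewrite -/(near h) -/(u h) in nM *; lra.
by apply: exprD_le => //; rewrite !mulr_ge0.
Qed.

(** (far + near)^(m+2) is expanded to first order in near. The factor 2 counts two errors of size
    u^2: the remainder of the expansion, and the replacement of the far moment by that of [F], which
    costs one u and is multiplied by E(k near), costing another. The coefficient of [eta] collects
    the three decorrelation errors. *)
Lemma recursion_integrand_le h :
  `|\int[mu]_x (F x ^+ m.+2 * k h x)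
    - m.+2%:R * (\int[mu]_x F x ^+ m.+1) * \int[mu]_x (F x * k h x)| <=
  2 * m.+2%:R ^+ 2 * M ^+ 3 * u h ^+ 2 * (2 ^+ m * (a + (2 * M * u h) ^+ m))
  + (1 + m.+2%:R + m.+2%:R * M ^+ m.+1) * (eta * n ^+ m.+2).
Proof.
set c := (m.+2%:R : R); have c0 : 0 <= c by exact: ler0n.
set W := 2 ^+ m * (a + (2 * M * u h) ^+ m).
pose S x := (`|far h x| + `|near h x|) ^+ m.
have bS : bounded_mfun S.
  by apply: bounded_mfunX; apply: bounded_mfunD; exact: bounded_mfun_norm.
have S0 x : 0 <= S x by rewrite exprn_ge0// addr_ge0.
have bfx j : bounded_mfun (fun x => far h x ^+ j) by exact: bounded_mfunX.
have bFx j : bounded_mfun (fun x => F x ^+ j) by exact: bounded_mfunX.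
have SW : \int[mu]_x S x <= W by exact: S_le.
have W0 : 0 <= W by rewrite (le_trans _ SW)//; apply: Rintegral_ge0 => x _.
have nM x : `|near h x| <= M * u h by exact: norm_cpart_le.
have kM x : `|k h x| <= M by exact: norm_clip_le.
pose rem x := F x ^+ m.+2 - far h x ^+ m.+2 - c * near h x * far h x ^+ m.+1.
have brem : bounded_mfun rem.
  by apply: bounded_mfunB; [exact: bounded_mfunB|
    apply: bounded_mfunM => //; exact: bounded_mfunZ].
have x3 : `|\int[mu]_x (k h x * rem x)| <= c ^+ 2 * M ^+ 3 * u h ^+ 2 * W.
  apply: (@le_trans _ _ (\int[mu]_x (c ^+ 2 * M ^+ 3 * u h ^+ 2 * S x))); last first.
    by rewrite meanZ// ler_wpM2l// !mulr_ge0 ?exprn_ge0.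
  apply: norm_mean_le; [exact: bounded_mfunM|exact: bounded_mfunZ|move=> x].
  have := exprD_second_order m (far h x) (near h x); rewrite -Fsplit -/c -/(rem x) => hr.
  rewrite normrM (@le_trans _ _ (M * (c ^+ 2 * (M * u h) ^+ 2 * S x)))//; last first.
    by apply: ler_eq; ring.
  rewrite ler_pM// (le_trans hr)// ler_wpM2r ?(S0 x)//.
  by rewrite ler_wpM2l ?exprn_ge0// -(real_normK (num_real (near h x))) lerXn2r ?nnegrE// mulr_ge0.
have pq : `|\int[mu]_x (far h x ^+ m.+1) - \int[mu]_x (F x ^+ m.+1)| <= c * (M * u h) * W.
  rewrite distrC -meanB//.
  apply: (@le_trans _ _ (\int[mu]_x (c * (M * u h) * S x))); last first.
    by rewrite meanZ// ler_wpM2l// !mulr_ge0.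
  apply: norm_mean_le; [exact: bounded_mfunB|exact: bounded_mfunZ|move=> x].
  have := exprD_first_order m (far h x) (near h x); rewrite -Fsplit => /le_trans; apply.
  rewrite ler_wpM2r ?(S0 x)//.
  by rewrite ler_pM// ler_nat.
have cM : `|\int[mu]_x (k h x * near h x)| <= M * (M * u h).
  apply: norm_mean_le_cst; first exact: bounded_mfunM.
  by move=> x; rewrite normrM ler_pM.
have qM : `|\int[mu]_x (F x ^+ m.+1)| <= (M * n) ^+ m.+1.
  apply: norm_mean_le_cst => // x; rewrite normrX lerXn2r ?nnegrE//.
    by rewrite mulr_ge0// (le_trans _ n1).
  exact: norm_cpart_le.
have -> : \int[mu]_x (F x * k h x) =
    \int[mu]_x (k h x * far h x) + \int[mu]_x (k h x * near h x).
  rewrite -meanD; [|exact: bounded_mfunM|exact: bounded_mfunM].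
  by apply: eq_Rintegral => x _; rewrite (Fsplit h) mulrC mulrDr.
have -> : \int[mu]_x (F x ^+ m.+2 * k h x) = \int[mu]_x (k h x * far h x ^+ m.+2) +
    c * \int[mu]_x (k h x * near h x * far h x ^+ m.+1) + \int[mu]_x (k h x * rem x).
  have b1 : bounded_mfun (fun x => k h x * near h x * far h x ^+ m.+1).
    by apply: bounded_mfunM => //; exact: bounded_mfunM.
  have b2 : bounded_mfun (fun x => k h x * far h x ^+ m.+2) by exact: bounded_mfunM.
  rewrite -meanZ// -meanD//; last exact: bounded_mfunZ.
  rewrite -meanD; [|apply: bounded_mfunD => //; exact: bounded_mfunZ|exact: bounded_mfunM].
  by apply: eq_Rintegral => x _; rewrite /rem; ring.
have h1 := far_isolated h; have h2 := near_far_decorrelated h; have h3 := far1_isolated h.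
move: h1 h2 h3 x3 pq cM qM.
set X1 := \int[mu]_x _; set X2 := \int[mu]_x _; set Y := \int[mu]_x _.
set P := \int[mu]_x _; set Y' := \int[mu]_x _; set X3 := \int[mu]_x _.
set Q := \int[mu]_x _ => h1 h2 h3 x3 pq cM qM.
(* [X1], [X2], [X3] are the three terms of the expansion; [Y] and [Y'] are the means of k near and k
   far; [P] and [Q] are the moments of order m+1 of far and of [F]. *)
have -> : X1 + c * X2 + X3 - c * Q * (Y' + Y) =
   X3 + X1 + c * (X2 - Y * P) + c * (Y * (P - Q)) - c * (Q * Y') by ring.
have d1 : `|c * (X2 - Y * P)| <= c * (eta * n ^+ m.+2).
  by rewrite normrM (ger0_norm c0) ler_wpM2l.
have d2 : `|c * (Y * (P - Q))| <= c ^+ 2 * M ^+ 3 * u h ^+ 2 * W.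
  rewrite normrM (ger0_norm c0) normrM.
  apply: (@le_trans _ _ (c * (M * (M * u h) * (c * (M * u h) * W)))).
    by rewrite ler_wpM2l// ler_pM.
  by apply: ler_eq; ring.
have d3 : `|c * (Q * Y')| <= c * M ^+ m.+1 * (eta * n ^+ m.+2).
  rewrite normrM (ger0_norm c0) normrM.
  apply: (@le_trans _ _ (c * ((M * n) ^+ m.+1 * (eta * n)))).
    by rewrite ler_wpM2l// ler_pM.
  by apply: ler_eq; rewrite exprMn [n ^+ m.+2]exprSr; ring.
apply: (le_trans (ler_normB _ _)).
apply: (le_trans (lerD (ler_normD _ _) (lexx _))).
apply: (le_trans (lerD (lerD (ler_normD _ _) (lexx _)) (lexx _))).
apply: (le_trans (lerD (lerD (lerD (ler_normD _ _) (lexx _)) (lexx _)) (lexx _))).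
apply: (le_trans (lerD (lerD (lerD (lerD x3 h1) d1) d2) d3)).
by apply: ler_eq; ring.
Qed.

End near_far.

(** One factor of [F] is written as an integral over [h], and the estimate at [h] is integrated
    against [nu]. *)
Lemma moment_recursion (m : nat) : exists2 b : R, 0 < b & exists2 K : R, 0 <= K &
  forall nu, let n := fine (nu setT) in
  let F := cpart nu setT in let u (h : BH) := fine (nu (dball d h (b * ln n))) in
  1 <= n ->
  `|\int[mu]_x (F x ^+ m.+3)
    - m.+2%:R * (\int[mu]_x (F x ^+ 2)) * \int[mu]_x (F x ^+ m.+1)|
  <= K * ((\int[mu]_x (`|F x| ^+ m)) * (\int[nu]_h (u h ^+ 2))
          + \int[nu]_h (u h ^+ m.+2) + n^-1).
Proof.
(* The decorrelation error carries n^(m+2) and the integration over [h] one more [n]; exponent m+4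
   leaves 1/n. *)
pose L : R := m.+4%:R; have L0 : 0 <= L by exact: ler0n.
have [b1 b10 [C1 C10 iso1]] :=
  isolated_correlation groupH actH algA semiN mixing Af mean0 M0 fM 1 L0.
have [b2 b20 [C2 C20 iso2]] :=
  isolated_correlation groupH actH algA semiN mixing Af mean0 M0 fM m.+2 L0.
have [b3 b30 [C3 C30 pair3]] :=
  pair_correlation groupH actH algA semiN mixing Af mean0 M0 fM m.+1 L0.
(* The summand 1 makes [b] strictly positive, as the concentration condition asks of its
   constant. *)
pose b := b1 + b2 + b3 + 1; exists b; first by rewrite /b ltr_wpDl// !addr_ge0.
pose C := C1 + C2 + C3; have C0 : 0 <= C by rewrite !addr_ge0.
pose c : R := m.+2%:R; have c0 : 0 <= c by exact: ler0n.
pose K1 := 2 * c ^+ 2 * M ^+ 3 * 2 ^+ m.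
have K10 : 0 <= K1 by rewrite !mulr_ge0 ?exprn_ge0.
(* [K2] belongs to the term (2 M u)^m, which raises u^2 to u^(m+2); [K3] belongs to the
   decorrelation errors. *)
pose K2 := K1 * (2 * M) ^+ m; pose K3 := (1 + c + c * M ^+ m.+1) * C.
have K20 : 0 <= K2 by rewrite mulr_ge0// exprn_ge0// mulr_ge0.
have K30 : 0 <= K3 by rewrite mulr_ge0// addr_ge0 ?mulr_ge0 ?exprn_ge0// addr_ge0.
exists (K1 + K2 + K3); first by rewrite !addr_ge0.
move=> nu n F u n1; set a := \int[mu]_x (`|F x| ^+ m).
have n0 : 0 < n by rewrite (lt_le_trans _ n1).
have t0 : 0 <= ln n by rewrite ln_ge0.
have bF : bounded_mfun F by exact: bounded_mfun_cpart.
have bu : bounded_mfun u by exact: (bounded_mfun_ball_mass groupH).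
have bux j : bounded_mfun (fun h : BH => u h ^+ j) by exact: bounded_mfunX.
have bFx j : bounded_mfun (fun x => F x ^+ j) by exact: bounded_mfunX.
have a0 : 0 <= a by apply: Rintegral_ge0 => x _; rewrite exprn_ge0.
have le_eta (C' : R) : C' <= C -> C' * expR (- L * ln n) <= C * expR (- L * ln n).
  by move=> CC; rewrite ler_wpM2r ?expR_ge0.
have main h : `|\int[mu]_x (F x ^+ m.+2 * k h x)
    - c * (\int[mu]_x F x ^+ m.+1) * \int[mu]_x (F x * k h x)| <=
   K1 * a * u h ^+ 2 + K2 * u h ^+ m.+2 + K3 * (expR (- L * ln n) * n ^+ m.+2).
  apply: (le_trans (recursion_integrand_le (b := b) (L := L) n1 C0 _ _ _ h)).
  - move=> g0 g far; have := iso1 (ln n) g0 [:: g] t0 erefl.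
    under eq_Rintegral do rewrite big_seq1.
    move=> /(_ _)/le_trans; apply; last by apply: le_eta; rewrite /C; lra.
    move=> h'; rewrite inE => /eqP ->; apply: le_trans far.
    by rewrite ler_wpM2r// /b; lra.
  - move=> g0 hs shs far; apply: le_trans (iso2 (ln n) g0 hs t0 shs _) _.
      by move=> h' /far; apply: le_trans; rewrite ler_wpM2r// /b; lra.
    by apply: le_eta; rewrite /C; lra.
  - move=> g0 g hs shs far; apply: le_trans (pair3 (ln n) g0 g hs t0 shs _) _.
      by move=> h' /far; apply: le_trans; rewrite ler_wpM2r// /b; lra.
    by apply: le_eta; rewrite /C; lra.
  by apply: ler_eq; rewrite /K3 /K2 /K1 -/a -/n -/(u h) -/c !exprMn !exprS; ring.
have -> : \int[mu]_x (F x ^+ m.+3) = \int[nu]_h \int[mu]_x (F x ^+ m.+2 * k h x).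
  by rewrite -mean_cpart//; apply: eq_Rintegral => x _; rewrite exprSr.
have -> : \int[mu]_x (F x ^+ 2) = \int[nu]_h \int[mu]_x (F x * k h x).
  by rewrite -mean_cpart.
have bd1 := bounded_mfun_mean_k (bFx m.+2).
have bd2 := bounded_mfun_mean_k bF.
have -> : m.+2%:R * (\int[nu]_h \int[mu]_x (F x * k h x)) * \int[mu]_x (F x ^+ m.+1) =
    \int[nu]_h (c * (\int[mu]_x F x ^+ m.+1) * \int[mu]_x (F x * k h x)).
  rewrite RintegralZl//; last exact: bounded_mfun_integrable.
  by rewrite -/c; ring.
have int D (g : BH -> R) : measurable D -> bounded_mfun g -> nu.-integrable D (EFin \o g).
  exact: bounded_mfun_integrable.
rewrite -RintegralB//; [|exact: int|apply: int => //; exact: bounded_mfunZ].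
have bd3 := bounded_mfunB bd1 (bounded_mfunZ (c * (\int[mu]_x F x ^+ m.+1)) bd2).
apply: (le_trans (le_normr_Rintegral _ _)) => //; first exact: int.
apply: (@le_trans _ _ (\int[nu]_h (K1 * a * u h ^+ 2 + K2 * u h ^+ m.+2 +
    K3 * (expR (- L * ln n) * n ^+ m.+2)))).
  apply: le_Rintegral => //; apply: int => //; first exact: bounded_mfun_norm.
  apply: bounded_mfunD; last exact: bounded_mfun_cst.
  by apply: bounded_mfunD; exact: bounded_mfunZ.
rewrite RintegralD//; last 2 first.
- by apply: int => //; apply: bounded_mfunD; exact: bounded_mfunZ.
- by apply: int => //; exact: bounded_mfun_cst.
rewrite RintegralD//; [|by apply: int => //; exact: bounded_mfunZ..].
rewrite Rintegral_cst// !RintegralZl//; [|by apply: int; last exact: bux..].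
have -> : expR (- L * ln n) = n ^- m.+4.
  by rewrite mulNr expRN /L mulr_natl -lnXn// lnK// posrE exprn_gt0.
rewrite -/n; set I2 := \int[nu]_h (u h ^+ 2); set Im := \int[nu]_h (u h ^+ m.+2).
have I20 : 0 <= I2 by apply: Rintegral_ge0 => h _; rewrite sqr_ge0.
have Im0 : 0 <= Im by apply: Rintegral_ge0 => h _; rewrite exprn_ge0// fine_ge0.
have nE : n ^- m.+4 * n ^+ m.+2 * n = n^-1.
  by rewrite !exprS; field; rewrite !expf_eq0 ?andbT ?gt_eqF//= ?andbF.
rewrite -[K3 * _ * n]mulrA nE.
have aI0 : 0 <= a * I2 by rewrite mulr_ge0.
have ni0 : 0 <= n^-1 by rewrite invr_ge0 ltW.
have p1 : 0 <= K1 * Im by rewrite mulr_ge0.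
have p2 : 0 <= K1 * n^-1 by rewrite mulr_ge0.
have p3 : 0 <= K2 * (a * I2) by rewrite mulr_ge0.
have p4 : 0 <= K2 * n^-1 by rewrite mulr_ge0.
have p5 : 0 <= K3 * (a * I2) by rewrite mulr_ge0.
have p6 : 0 <= K3 * Im by rewrite mulr_ge0.
rewrite -mulrA; lra.
Qed.

Let mtr : measurable_fun setT (fun p : BH * X => (tr p.1 f p.2)%:E).
Proof.
apply/measurable_EFinP; apply: measurable_joint_translate.
exact: (algebra_measurable algA).
Qed.

(** Without truncation the integrand need not be integrable for every [x], so positive and negative
    parts are treated separately by Tonelli. *)
Lemma measurable_conv_action nu : measurable_fun setT (conv_action inv act nu f).
Proof.
rewrite /conv_action; apply: measurableT_comp => //.
under eq_fun do rewrite integralE.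
apply: emeasurable_funB.
- have := measurable_fun_fubini_tonelli_G (m1 := nu) _ (measurable_funepos mtr).
  move=> /(_ (funepos_ge0 _)); congr measurable_fun; apply/funext => x.
  by apply: eq_integral => h _; rewrite !funeposE.
- have := measurable_fun_fubini_tonelli_G (m1 := nu) _ (measurable_funeneg mtr).
  move=> /(_ (funeneg_ge0 _)); congr measurable_fun; apply/funext => x.
  by apply: eq_integral => h _; rewrite !funenegE.
Qed.

(** For each [h] the two integrands agree for almost every [x]. The double integral of their
    distance [D] is therefore 0, and by Tonelli they agree, for almost every [x], at almost every
    [h]. *)
Lemma ae_eq_conv_action nu :
  {ae mu, forall x, conv_action inv act nu f x = cpart nu setT x}.
Proof.
pose D (p : BH * X) : \bar R := (`|tr p.1 f p.2 - k p.1 p.2|)%:E.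
have mD : measurable_fun setT D.
  apply/measurable_EFinP; apply: measurableT_comp => //.
  by apply: measurable_funB; [exact/measurable_EFinP|case: bkk].
have D0 p : (0 <= D p)%E by rewrite lee_fin.
have int0 : (\int[mu]_x \int[nu]_h D (h, x) = 0)%E.
  rewrite -(fubini_tonelli (m1 := nu) (m2 := mu) D)//; apply: integral0_eq => h _.
  have mDh : measurable_fun setT (fun x => D (h, x)).
    exact: (measurableT_comp mD (measurable_pair1 h)).
  have := (ae_eq_integral_abs mu measurableT mDh).2.
  under eq_integral do rewrite gee0_abs//.
  apply; have := ae_act actH (inv h) fM; apply: filterS => x /clip_id E _.
  by rewrite /D /translate/= E subrr normr0.
have mDx : measurable_fun setT (fun x => \int[nu]_(h in [set: BH]) D (h, x))%E.
  exact: (measurable_fun_fubini_tonelli_G (m1 := nu)).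
have := (ae_eq_integral_abs mu measurableT mDx).1.
under eq_integral do rewrite gee0_abs ?integral_ge0//.
move=> /(_ int0); apply: filterS => x /(_ I) Dx0.
have mDh : measurable_fun setT (fun h : BH => D (h, x)).
  exact: (measurableT_comp mD (measurable_pair2 x)).
have := (ae_eq_integral_abs nu measurableT mDh).1.
under eq_integral do rewrite gee0_abs//.
move=> /(_ Dx0) DE; congr fine; apply: ae_eq_integral => //.
- exact: (measurableT_comp mtr (measurable_pair2 x)).
- apply/measurable_EFinP; case: bkk => mk _.
  exact: (measurableT_comp mk (measurable_pair2 x)).
- apply: filterS DE => h /(_ I) /eqP; rewrite /D/= eqe normr_eq0 subr_eq0.
  by move=> /eqP -> _.
Qed.

End moment_recursion.

(** * Weierstrass approximation on the unit interval *)

Section bernstein.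
Context {R : realType}.
Implicit Types (g h : nat -> R) (x : R).

(* [(bernstein n g).[x]] is the expectation of [g] under the binomial law of
   parameters [n] and [x]; the recursion conditions on the first trial. *)
Fixpoint bernstein (n : nat) g : {poly R} :=
  if n is n'.+1 then (1 - 'X) * bernstein n' g + 'X * bernstein n' (g \o S)
  else (g 0%N)%:P.

Lemma bernsteinS n g x : (bernstein n.+1 g).[x] =
  (1 - x) * (bernstein n g).[x] + x * (bernstein n (g \o S)).[x].
Proof. by rewrite /= hornerD !hornerM hornerD hornerN hornerX hornerC. Qed.

Lemma bernstein_le n g h x : 0 <= x <= 1 ->
  (forall k, (k <= n)%N -> g k <= h k) -> (bernstein n g).[x] <= (bernstein n h).[x].
Proof.
move=> /andP[x0 x1]; elim: n g h => [|n IH] g h gh.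
  by rewrite !hornerC gh.
rewrite !bernsteinS lerD// ler_wpM2l ?subr_ge0//; apply: IH => k kn; rewrite /=.
- by rewrite gh// ltnW.
- exact: gh.
Qed.

Lemma bernstein_affine n g (a b : R) x :
  (bernstein n (fun k => a + b * g k)).[x] = a + b * (bernstein n g).[x].
Proof.
elim: n g => [|n IH] g; first by rewrite !hornerC.
by rewrite !bernsteinS IH [(fun k => a + b * g k) \o S](_ : _ =
  (fun k => a + b * (g \o S) k))// IH; ring.
Qed.

(** The centre [c] is general because the shift by [S] turns it into [c - 1] in the induction; at c
    = n x the value is the binomial variance. *)
Lemma bernstein_sqr n (c x : R) :
  (bernstein n (fun k => (k%:R - c) ^+ 2)).[x] = (n%:R * x - c) ^+ 2 + n%:R * (x * (1 - x)).
Proof.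
elim: n c => [|n IH] c; first by rewrite !hornerC; ring.
rewrite bernsteinS IH [_ \o S](_ : _ = (fun k => (k%:R - (c - 1)) ^+ 2)); last first.
  by apply/funext => k /=; rewrite -natr1; congr (_ ^+ 2); ring.
by rewrite IH -[n.+1%:R]natr1; ring.
Qed.

(** Heine's theorem by compactness, with only [x] confined to the interval. *)
Lemma unif_continuous_unit_interval (psi : R -> R) (eps : R) : 0 < eps ->
  continuous psi -> exists2 del : R, 0 < del &
  forall x y, 0 <= x <= 1 -> `|x - y| < del -> `|psi x - psi y| < eps.
Proof.
move=> eps0 cpsi.
pose Q (del x : R) := forall y, `|x - y| < del -> `|psi x - psi y| < eps.
have cov : \forall del \near (0 : R)^'+, `[0, 1] `<=` Q del.
  apply: (iffLR (compact_near_coveringP _) (@segment_compact R 0 1) _ _ _ _) => x _.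
  have /cvgrPdist_lt/(_ (eps / 2)) := cpsi x.
  rewrite divr_gt0// => /(_ isT)/nbhs_ballP[eta /= eta0 Heta].
  exists (ball x (eta / 2), [set r | r < eta / 2]).
    split; first by apply: nbhsx_ballx; rewrite divr_gt0.
    by apply: nbhs_right_lt; rewrite divr_gt0.
  move=> [x' del] [/= xx' del_eta] y x'y.
  have p1 : `|psi x - psi x'| < eps / 2.
    by apply: Heta; rewrite /ball/=; apply: lt_le_trans xx' _; lra.
  have p2 : `|psi x - psi y| < eps / 2.
    apply: Heta; rewrite /ball/= in xx' *.
    have := ler_distD x' x y; lra.
  have := ler_distD (psi x) (psi x') (psi y); rewrite [`|psi x' - psi x|]distrC; lra.
have [del [del0 Hdel]] : exists del, 0 < del /\ `[0, 1] `<=` Q del.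
  near (0 : R)^'+ => del; exists del; split => //.
  by near: del.
exists del => // x y x01; apply: Hdel.
by rewrite /= in_itv/=.
Unshelve. all: by end_near.
Qed.

(** Bernstein's proof by Chebyshev: the values of [psi] at the nodes differ from [psi x] by at most
    eps/2 plus a multiple of the squared deviation. [bernstein] is monotone in its data, and the
    mean squared deviation is a variance. *)
Lemma weierstrass_unit_interval (psi : R -> R) (eps : R) : 0 < eps ->
  continuous psi -> (exists M, forall x, `|psi x| <= M) ->
  exists p : {poly R}, forall x, 0 <= x <= 1 -> `|p.[x] - psi x| <= eps.
Proof.
move=> eps0 cpsi [M psiM].
have M0 : 0 <= M by rewrite (le_trans _ (psiM 0)).
have [del del0 unif] := unif_continuous_unit_interval (divr_gt0 eps0 (ltr0n _ 2)) cpsi.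
(* At a node further than [del] from [x], [c] times the squared distance exceeds the largest
   possible oscillation 2 M. *)
pose c := 2 * M / del ^+ 2.
have c0 : 0 <= c by rewrite !mulr_ge0// invr_ge0 sqr_ge0.
have [n ncn] : exists n : nat, c / n.+1%:R <= eps / 2.
  exists (Num.truncn (c / (eps / 2))); rewrite ler_pdivrMr//.
  rewrite -ler_pdivrMl ?divr_gt0// mulrC.
  by apply/ltW; exact: truncnS_gt.
pose g k := psi (k%:R / n.+1%:R).
exists (bernstein n.+1 g) => x x01.
have nn0 : (n.+1%:R : R) != 0 by [].
have dev k : (k <= n.+1)%N ->
    `|g k - psi x| <= eps / 2 + c / n.+1%:R ^+ 2 * (k%:R - n.+1%:R * x) ^+ 2.
  move=> kn; have -> : c / n.+1%:R ^+ 2 * (k%:R - n.+1%:R * x) ^+ 2 =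
      c * (k%:R / n.+1%:R - x) ^+ 2 by field.
  have [close|apart] := ltP (`|k%:R / n.+1%:R - x|) del.
    apply: (@le_trans _ _ (eps / 2)); last by rewrite lerDl mulr_ge0// sqr_ge0.
    apply/ltW/unif => //; rewrite divr_ge0//=.
    by rewrite ler_pdivrMr// mul1r ler_nat.
  apply: (@le_trans _ _ (2 * M)).
    have := ler_normB (g k) (psi x); have := psiM x.
    by have := psiM (k%:R / n.+1%:R); rewrite /g; lra.
  apply: (@le_trans _ _ (c * del ^+ 2)).
    by rewrite /c divfK// sqrf_eq0 gt_eqF.
  apply: (@le_trans _ _ (c * (k%:R / n.+1%:R - x) ^+ 2)).
    rewrite ler_wpM2l// -[leRHS]real_normK ?num_real//.
    by rewrite lerXn2r ?nnegrE// ltW.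
  by rewrite lerDr divr_ge0// ltW.
set C2 := c / n.+1%:R ^+ 2 in dev.
have C20 : 0 <= C2 by rewrite divr_ge0// exprn_ge0.
have var : (bernstein n.+1 (fun k => (k%:R - n.+1%:R * x) ^+ 2)).[x] <= n.+1%:R.
  rewrite bernstein_sqr subrr expr0n add0r.
  by case/andP: x01 => x0 x1; rewrite ler_piMr//; nra.
have C2n : C2 * n.+1%:R <= eps / 2.
  by apply: le_trans ncn; apply: ler_eq; rewrite /C2; field.
have varC := le_trans (ler_wpM2l C20 var) C2n.
rewrite ler_distl; apply/andP; split.
- have := @bernstein_le n.+1 (fun k => (psi x - eps / 2) + - C2 *
    (k%:R - n.+1%:R * x) ^+ 2) g x x01.
  rewrite bernstein_affine => /(_ _)/(le_trans _); apply; last first.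
    by move=> k /dev; rewrite ler_distl => /andP[]; lra.
  lra.
- have := @bernstein_le n.+1 g (fun k => (psi x + eps / 2) + C2 *
    (k%:R - n.+1%:R * x) ^+ 2) x x01.
  rewrite bernstein_affine => /(_ _)/le_trans; apply.
    by move=> k /dev; rewrite ler_distl => /andP[]; lra.
  lra.
Qed.

End bernstein.

(** * Test functions determined by moments *)

Section taylor_cos.
Context {R : realType}.

(** The Taylor polynomial at s = 0 of s -> cos(s u + b), of degree below [n]. The k-th derivative of
    cos is written as a phase shift by k pi/2, so that differentiation stays within the family. *)
Definition cos_taylor (n : nat) (u b : R) : {poly R} :=
  \poly_(k < n) (cos (b + k%:R * (pi / 2)) * u ^+ k / k`!%:R).

Lemma deriv_cos_taylor n u b :
  (cos_taylor n.+1 u b)^`() = u *: cos_taylor n u (b + pi / 2).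
Proof.
apply/polyP => i; rewrite coef_deriv coefZ !coef_poly ltnS.
case: ifP => _; last by rewrite mul0rn mulr0.
have -> : b + i.+1%:R * (pi / 2) = b + pi / 2 + i%:R * (pi / 2).
  by rewrite -[i.+1%:R]natr1; ring.
have f0 : (i`!%:R : R) != 0 by rewrite pnatr_eq0 -lt0n fact_gt0.
have i0 : (i.+1%:R : R) != 0 by rewrite pnatr_eq0.
rewrite factS natrM -mulr_natr exprS; field.
by rewrite f0 addrC natr1 i0.
Qed.

Lemma ge0_of_deriv_ge0 (f df : R -> R) : f 0 = 0 ->
  (forall x : R, is_derive x 1 f (df x)) -> (forall x, 0 <= x -> 0 <= df x) ->
  forall x, 0 <= x -> 0 <= f x.
Proof.
move=> f0 fdf df0 x x0; rewrite -f0.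
apply: (@ger0_derive1_ndecry _ f 0) => //.
- move=> y; rewrite in_itv/= andbT => y0.
  by rewrite derive1E (@derive_val _ _ _ _ _ _ _ (fdf y)) df0// ltW.
- apply: continuous_subspaceT => y; apply: differentiable_continuous.
  by apply/derivable1_diffP; case: (fdf y).
Qed.

(** Induction for all phases at once: the derivative of the remainder is [u] times the remainder of
    the previous order with phase b + pi/2. The bound is integrated by showing that h + g and h - g
    are nondecreasing from 0. *)
Lemma cos_taylor_bound n (u b s : R) : 0 <= s ->
  `|cos (s * u + b) - (cos_taylor n u b).[s]| <= `|u| ^+ n * s ^+ n / n`!%:R.
Proof.
elim: n b s => [|n IH] b s s0.
  rewrite /cos_taylor; have -> : \poly_(k < 0) (cos (b + k%:R * (pi / 2)) * u ^+ k / k`!%:R) = 0.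
    by apply/polyP => i; rewrite coef_poly coef0.
  by rewrite horner0 subr0 !expr0 mulr1 divr1 cos_max.
pose g x := cos (x * u + b) - (cos_taylor n.+1 u b).[x].
pose h (x : R) : R := `|u| ^+ n.+1 * x ^+ n.+1 / n.+1`!%:R.
pose dg x := u * (cos (x * u + (b + pi / 2)) - (cos_taylor n u (b + pi / 2)).[x]).
pose dh (x : R) : R := `|u| ^+ n.+1 * x ^+ n / n`!%:R.
have dgP (x : R) : is_derive x 1 g (dg x).
  have d1 : is_derive x 1 (fun x : R => x * u + b) u.
    have := is_derive_poly (u *: 'X + b%:P) x.
    rewrite derivD derivZ derivX derivC addr0 hornerZ hornerC mulr1.
    congr is_derive; apply/funext => y.
    by rewrite hornerD hornerZ hornerX hornerC mulrC.
  have d2 := @is_derive1_comp _ cos (fun x : R => x * u + b) x _ _ (is_derive_cos _) d1.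
  have -> : dg x = - sin (x * u + b) * u - (cos_taylor n.+1 u b)^`().[x].
    by rewrite deriv_cos_taylor hornerZ /dg addrA cosDpihalf; ring.
  exact: (is_deriveB d2 (is_derive_poly _ x)).
have dhP (x : R) : is_derive x 1 h (dh x).
  have := is_derive_poly ((`|u| ^+ n.+1 / n.+1`!%:R) *: 'X^(n.+1)) x.
  rewrite derivZ derivXn hornerZ hornerMn hornerXn.
  have -> : `|u| ^+ n.+1 / n.+1`!%:R * (x ^+ n.+1.-1 *+ n.+1) = dh x.
    have f0 : (n`!%:R : R) != 0 by rewrite pnatr_eq0 -lt0n fact_gt0.
    have i0 : (n.+1%:R : R) != 0 by rewrite pnatr_eq0.
    rewrite /dh factS natrM -mulr_natr /=; field.
    by rewrite f0 addrC natr1 i0.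
  congr is_derive; apply/funext => y.
  by rewrite hornerZ hornerXn /h mulrAC.
have gh x : 0 <= x -> `|dg x| <= dh x.
  move=> x0; rewrite /dg normrM (le_trans (ler_wpM2l (normr_ge0 u) (IH _ _ x0)))//.
  by apply: ler_eq; rewrite /dh exprS !mulrA.
have g0 : g 0 = 0.
  rewrite /g mul0r add0r horner_coef0 coef_poly/= mul0r addr0 expr0 mulr1 divr1.
  exact: subrr.
have h0 : h 0 = 0 by rewrite /h expr0n/= mulr0 mul0r.
rewrite ler_norml; apply/andP; split.
- rewrite -subr_ge0 opprK.
  apply: (@ge0_of_deriv_ge0 (fun x => g x + h x) (fun x => dg x + dh x)) => //.
  + by rewrite g0 h0 addr0.
  + by move=> x /gh; rewrite ler_norml -[- _ <= _]subr_ge0 opprK => /andP[].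
- rewrite -subr_ge0.
  apply: (@ge0_of_deriv_ge0 (fun x => h x - g x) (fun x => dh x - dg x)) => //.
  + by rewrite g0 h0 subrr.
  + by move=> x /gh; rewrite ler_norml subr_ge0 => /andP[].
Qed.

End taylor_cos.

Section integrable_domination.
Context {d : measure_display} {T : measurableType d} {R : realType}.
Variable mu : {measure set T -> \bar R}.
Implicit Types f g h : T -> R.

Lemma integrable_dist_le f g h : measurable_fun setT f ->
  mu.-integrable setT (EFin \o g) -> mu.-integrable setT (EFin \o h) ->
  (forall x, `|f x - g x| <= h x) -> mu.-integrable setT (EFin \o f).
Proof.
move=> mf ig ih fgh.
apply: (@le_integrable _ _ _ mu setT measurableT _ (fun x => `|(g x)%:E| + (h x)%:E)%E).
- exact/measurable_EFinP.
- move=> x _ /=; have h0 : 0 <= h x by rewrite (le_trans _ (fgh x)).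
  rewrite lee_fin [leRHS]ger0_norm ?addr_ge0//.
  by have := ler_normD (f x - g x) (g x); rewrite subrK; have := fgh x; lra.
- by apply: integrableD => //; exact: integrable_abse.
Qed.

Lemma Rintegral_dist_le f g h : mu.-integrable setT (EFin \o f) ->
  mu.-integrable setT (EFin \o g) -> mu.-integrable setT (EFin \o h) ->
  (forall x, `|f x - g x| <= h x) ->
  `|\int[mu]_x f x - \int[mu]_x g x| <= \int[mu]_x h x.
Proof.
move=> fi gi hi fgh; rewrite -RintegralB//.
have fgi : mu.-integrable setT (EFin \o (fun x => f x - g x)).
  have := integrableB measurableT fi gi; apply: eq_integrable => //.
apply: (le_trans (le_normr_Rintegral _ _)) => //.
apply: le_Rintegral => //.
have := integrable_abse fgi; exact: eq_integrable.
Qed.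

End integrable_domination.

(** * From polynomial to bounded continuous test functions *)

Section test_functions.
Context {R : realType} {dX dY : measure_display}.
Context {X : measurableType dX} {Y : measurableType dY}.
Variables (mu : probability X R) (P : probability Y R).
Variables (F : nat -> X -> R) (Z : Y -> R).
Hypotheses (mF : forall T, measurable_fun setT (F T)) (mZ : measurable_fun setT Z).
Implicit Types g h phi : R -> R.

(** Integrability travels with the convergence, so that the class contains unbounded functions such
    as powers and is closed under linear combinations. *)
Definition cvg_test g := [/\ measurable_fun setT g,
  forall T, mu.-integrable setT (EFin \o (g \o F T)),
  P.-integrable setT (EFin \o (g \o Z)) &
  (fun T => \int[mu]_x g (F T x)) @ \oo --> \int[P]_y g (Z y)].

Lemma cvg_testD g h : cvg_test g -> cvg_test h -> cvg_test (fun y => g y + h y).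
Proof.
move=> [mg gF gZ gc] [mh hF hZ hc]; split.
- exact: measurable_funD.
- by move=> T; have := integrableD measurableT (gF T) (hF T); apply: eq_integrable => //.
- by have := integrableD measurableT gZ hZ; apply: eq_integrable => //.
- rewrite (RintegralD measurableT gZ hZ).
  under eq_fun do rewrite (RintegralD measurableT (gF _) (hF _)).
  exact: cvgD.
Qed.

Lemma cvg_testZ (c : R) g : cvg_test g -> cvg_test (fun y => c * g y).
Proof.
move=> [mg gF gZ gc]; split.
- exact: measurable_funM.
- by move=> T; have := integrableZl measurableT c (gF T); apply: eq_integrable => //.
- by have := integrableZl measurableT c gZ; apply: eq_integrable => //.
- rewrite (RintegralZl c measurableT gZ).
  under eq_fun do rewrite (RintegralZl c measurableT (gF _)).
  by apply: cvgM => //; exact: cvg_cst.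
Qed.

(** The error [h] may be unbounded: it is itself a test function, so its mean under [F T] is
    eventually close to its small mean under [Z]. *)
Lemma cvg_test_approx g : measurable_fun setT g ->
  (forall eps : R, 0 < eps -> exists g' h, [/\ cvg_test g', cvg_test h,
    forall y, `|g y - g' y| <= h y & \int[P]_y h (Z y) < eps]) ->
  cvg_test g.
Proof.
move=> mg app.
have [g1 [h1 [[_ g1F g1Z _] [_ h1F h1Z _] gh1 _]]] := app 1 ltr01.
have gF T : mu.-integrable setT (EFin \o (g \o F T)).
  apply: (integrable_dist_le _ (g1F T) (h1F T)) => [|x]; last exact: gh1.
  exact: measurableT_comp.
have gZ : P.-integrable setT (EFin \o (g \o Z)).
  apply: (integrable_dist_le _ g1Z h1Z) => [|x]; last exact: gh1.
  exact: measurableT_comp.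
split=> //; apply/cvgrPdist_le => /= eps eps0.
(* One quarter goes to the mean of [h] under [Z], two to its mean under [F T], and one to the
   convergence for [g']. *)
have e4 : 0 < eps / 4 by rewrite divr_gt0.
have [g' [h [[_ g'F g'Z g'c] [_ hF hZ hc] gh hZe]]] := app (eps / 4) e4.
have ng := (cvgrPdist_le _ _).1 g'c (eps / 4) e4.
have nh := (cvgrPdist_le _ _).1 hc (eps / 4) e4.
near=> T.
have hT : `|\int[P]_y h (Z y) - \int[mu]_x h (F T x)| <= eps / 4.
  by near: T; exact: nh.
have g'T : `|\int[P]_y g' (Z y) - \int[mu]_x g' (F T x)| <= eps / 4.
  by near: T; exact: ng.
have a1 : `|\int[P]_y g (Z y) - \int[P]_y g' (Z y)| <= \int[P]_y h (Z y).
  by apply: Rintegral_dist_le; [exact: gZ|exact: g'Z|exact: hZ|move=> y; exact: gh].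
have a2 : `|\int[mu]_x g (F T x) - \int[mu]_x g' (F T x)| <= \int[mu]_x h (F T x).
  by apply: Rintegral_dist_le; [exact: gF|exact: g'F|exact: hF|move=> y; exact: gh].
move: hZe hT g'T a1 a2; rewrite !ler_distl => ? /andP[? ?] /andP[? ?] /andP[? ?] /andP[? ?].
by apply/andP; split; lra.
Unshelve. all: by end_near.
Qed.

Hypothesis moments : forall k, cvg_test (fun y => y ^+ k).
Hypothesis growth : forall (t eps : R), 0 < eps -> exists n : nat,
  t ^+ (2 * n) / (2 * n)`!%:R * \int[P]_y (Z y ^+ (2 * n)) < eps.

Lemma cvg_test_cst (c : R) : cvg_test (fun _ => c).
Proof.
have := cvg_testZ c (moments 0); congr cvg_test.
by apply/funext => y; rewrite expr0 mulr1.
Qed.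

(** At even order the Taylor error is a monomial without absolute value, hence a test function, and
    [growth] makes its mean small. *)
Lemma cvg_test_cos (t b : R) : cvg_test (fun y => cos (t * y + b)).
Proof.
apply: cvg_test_approx.
  apply: measurableT_comp; first by apply: continuous_measurable_fun; exact: continuous_cos.
  by apply: measurable_funD => //; exact: measurable_funM.
move=> eps eps0; have [n nt] := growth t eps0.
have taylorP (m : nat) : cvg_test (fun y => \sum_(k < m)
    cos (b + k%:R * (pi / 2)) / k`!%:R * t ^+ k * y ^+ k).
  elim: m => [|m IH].
    by under eq_fun do rewrite big_ord0; exact: cvg_test_cst.
  under eq_fun do rewrite big_ord_recr/=; apply: cvg_testD => //.
  exact/cvg_testZ/moments.
exists (fun y => \sum_(k < 2 * n) cos (b + k%:R * (pi / 2)) / k`!%:R * t ^+ k * y ^+ k).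
exists (fun y => t ^+ (2 * n) / (2 * n)`!%:R * y ^+ (2 * n)); split=> //.
- exact/cvg_testZ/moments.
- move=> y; have := @cos_taylor_bound R (2 * n) (t * y) b 1 ler01.
  have -> : `|t * y| ^+ (2 * n) * 1 ^+ (2 * n) / (2 * n)`!%:R =
      t ^+ (2 * n) / (2 * n)`!%:R * y ^+ (2 * n).
    rewrite expr1n mulr1 !exprM real_normK ?num_real// -!exprM exprMn; ring.
  rewrite mul1r horner_poly; congr (`|_ - _| <= _); apply: eq_bigr => k _.
  by rewrite expr1n mulr1 exprMn; ring.
- by rewrite RintegralZl//; have [] := moments (2 * n).
Qed.

(** The cosine of arbitrary frequency and phase is what lets the induction on [k] absorb one more
    sine. *)
Lemma cvg_test_sin_cos (k : nat) (a t b : R) :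
  cvg_test (fun y => sin (a * y) ^+ k * cos (t * y + b)).
Proof.
elim: k t b => [|k IH] t b.
  by under eq_fun do rewrite expr0 mul1r; exact: cvg_test_cos.
(* sin A cos B = (sin (B + A) - sin (B - A)) / 2 and sin C = cos (C - pi / 2) *)
have := cvg_testD (cvg_testZ 2^-1 (IH (t + a) (b - pi / 2)))
  (cvg_testZ (- 2^-1) (IH (t - a) (b - pi / 2))).
congr cvg_test; apply/funext => y.
have -> : (t + a) * y + (b - pi / 2) = ((t * y + b) + a * y) - pi / 2 by ring.
have -> : (t - a) * y + (b - pi / 2) = ((t * y + b) - a * y) - pi / 2 by ring.
by rewrite !cosBpihalf sinD sinB exprS; field.
Qed.

Lemma cvg_test_poly_sin (a : R) (p : {poly R}) : cvg_test (fun y => p.[sin (a * y)]).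
Proof.
have mono k : cvg_test (fun y => sin (a * y) ^+ k).
  have := cvg_test_sin_cos k a 0 0; congr cvg_test; apply/funext => y.
  by rewrite mul0r addr0 cos0 mulr1.
under eq_fun do rewrite horner_coef.
elim: (size p) => [|m IH].
  by under eq_fun do rewrite big_ord0; exact: cvg_test_cst.
under eq_fun do rewrite big_ord_recr/=; apply: cvg_testD => //.
exact: cvg_testZ.
Qed.

(** On |y| <= K the angle [a * y] stays within [-1/2, 1/2], so y is recovered from sin(a y) by
    [asin] and [phi] becomes a continuous function [psi] of x = (sin(a y) + 1)/2 in [0, 1], close to
    a polynomial. Where |y| > K, the error is dominated by a multiple of y^2. *)
Lemma cvg_test_bounded_continuous phi : continuous phi ->
  (exists M : R, forall y, `|phi y| <= M) -> cvg_test phi.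
Proof.
move=> cphi [M phiM]; have M0 : 0 <= M by rewrite (le_trans _ (phiM 0)).
apply: cvg_test_approx; first exact: continuous_measurable_fun.
move=> eps eps0; pose e1 := eps / 4; have e10 : 0 < e1 by rewrite divr_gt0.
(* Bounds the error at every point: [M] for [phi], [M] for [psi] and [e1] for the polynomial. *)
pose C := 2 * M + e1; have C0 : 0 < C by rewrite ltr_wpDl// mulr_ge0.
pose m2 := \int[P]_y (Z y ^+ 2).
have m20 : 0 <= m2 by apply: Rintegral_ge0 => y _; exact: sqr_ge0.
(* Large enough that the mean of C y^2 / K^2 is at most eps/2. *)
pose K := 1 + 2 * C * (m2 + 1) / eps.
have q0 : 0 < 2 * C * (m2 + 1) / eps by rewrite divr_gt0// !mulr_gt0// ltr_wpDl.
have K1 : 1 <= K by rewrite lerDl ltW.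
have K0 : 0 < K by rewrite (lt_le_trans _ K1).
pose a := (2 * K)^-1; have a0 : 0 < a by rewrite invr_gt0 mulr_gt0.
pose s1 : R := sin (2^-1).
have pi2 := @pihalf_ge1 R.
have s1_lt1 : s1 < 1.
  by rewrite -(@sin_pihalf R) ltr_sin ?in_itv/= ?lexx ?andbT//; lra.
have s1_gt0 : 0 < s1 by apply: sin_gt0_pihalf; lra.
(* Truncation at sin(1/2) < 1 keeps the argument of [asin] inside the open interval where it is
   continuous, and changes nothing when |y| <= K. *)
pose cl (v : R) := Num.max (- s1) (Num.min s1 v).
have clP v : - s1 <= cl v <= s1.
  by rewrite /cl le_max lexx/= ge_max ge_min lexx/= andbT; lra.
pose psi x := phi (2 * K * asin (cl (2 * x - 1))).
have cpsi : continuous psi.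
  have ccl : continuous cl.
    move=> v; apply: (@continuous_max R R (fun _ => - s1) (fun v => Num.min s1 v) v).
      exact: cvg_cst.
    by apply: (@continuous_min R R (fun _ => s1) id v); [exact: cvg_cst|exact: cvg_id].
  have caff : continuous (fun x : R => 2 * x - 1).
    move=> x; apply: cvgB; last exact: cvg_cst.
    by apply: cvgM; [exact: cvg_cst|exact: cvg_id].
  have casin x : {for cl (2 * x - 1), continuous (@asin R)}.
    by apply: continuous_asin; have /andP[? ?] := clP (2 * x - 1); lra.
  have c1 : continuous (fun x : R => 2 * K * asin (cl (2 * x - 1))).
    move=> x; apply: cvgM; first exact: cvg_cst.
    exact: (continuous_comp (continuous_comp (caff x) (ccl _)) (casin x)).
  by move=> x; exact: (continuous_comp (c1 x) (cphi _)).
have [p pP] := weierstrass_unit_interval e10 cpsi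
  (ex_intro _ M (fun x => phiM (2 * K * asin (cl (2 * x - 1))))).
pose q := p \Po (2^-1 *: 'X + (2^-1)%:P).
exists (fun y => q.[sin (a * y)]), (fun y => e1 + C / K ^+ 2 * y ^+ 2); split.
- exact: cvg_test_poly_sin.
- by apply: cvg_testD; [exact: cvg_test_cst|apply: cvg_testZ; exact: moments].
- move=> y; pose x := 2^-1 * sin (a * y) + 2^-1.
  have -> : q.[sin (a * y)] = p.[x].
    by rewrite horner_comp hornerD hornerZ hornerX hornerC.
  have x01 : 0 <= x <= 1.
    by have := sin_geN1 (a * y); have := sin_le1 (a * y); rewrite /x; lra.
  have xE : 2 * x - 1 = sin (a * y) by rewrite /x; field.
  have px := pP x x01.
  have hp : 0 <= C / K ^+ 2 * y ^+ 2.
    by rewrite mulr_ge0 ?sqr_ge0// divr_ge0 ?sqr_ge0// ltW.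
  have [yK|Ky] := leP `|y| K.
    suff psiE : psi x = phi y.
      by rewrite distrC -psiE; apply: (le_trans px); rewrite lerDl.
    move: yK; rewrite ler_norml => /andP[yK1 yK2].
    have aK : a * K = 2^-1 by rewrite /a; field; rewrite gt_eqF.
    have ay1 : - 2^-1 <= a * y by rewrite -aK -mulrN ler_pM2l.
    have ay2 : a * y <= 2^-1 by rewrite -aK ler_pM2l.
    have ayI : a * y \in `[- (pi / 2), pi / 2] by rewrite in_itv/=; lra.
    have sy2 : sin (a * y) <= s1.
      rewrite leNgt; apply/negP; rewrite ltr_sin ?in_itv/=//; lra.
    have sy1 : - s1 <= sin (a * y).
      rewrite leNgt; apply/negP; rewrite -sinN ltr_sin ?in_itv/=//; lra.
    rewrite /psi xE /cl min_r// max_r// sinK//; congr phi.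
    by rewrite /a; field; rewrite gt_eqF.
  apply: (@le_trans _ _ C).
    have := ler_distD (psi x) (phi y) p.[x]; have := ler_normB (phi y) (psi x).
    have := phiM y; have := phiM (2 * K * asin (cl (2 * x - 1))).
    by rewrite -/(psi x) [`|psi x - _|]distrC /C; lra.
  apply: (@le_trans _ _ (C / K ^+ 2 * y ^+ 2)); last by rewrite lerDr ltW.
  rewrite mulrAC ler_pdivlMr ?exprn_gt0// ler_pM2l// -[leRHS]real_normK ?num_real//.
  by rewrite lerXn2r ?nnegrE// ltW.
- have [_ _ iZ _] := moments 2; have [_ _ i1 _] := cvg_test_cst e1.
  have [_ _ i2 _] := cvg_testZ (C / K ^+ 2) (moments 2).
  rewrite (RintegralD measurableT i1 i2) (RintegralZl _ measurableT iZ) mean_cst -/m2.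
  have CK : C / K ^+ 2 * m2 <= eps / 2.
    rewrite mulrAC ler_pdivrMr ?exprn_gt0//.
    apply: (@le_trans _ _ (eps / 2 * K)).
      rewrite /K mulrDr mulr1; have -> : eps / 2 * (2 * C * (m2 + 1) / eps) = C * (m2 + 1).
        by field; rewrite gt_eqF.
      by have := divr_gt0 eps0 (ltr0n R 2); lra.
    by rewrite ler_pM2l ?divr_gt0// expr2 ler_peMr// ltW.
  by rewrite /e1; lra.
Qed.

End test_functions.

(** * Gaussian moments *)

Section gaussian_moments.
Context {R : realType}.
Variable sigma : R.
Hypothesis sigma0 : sigma != 0.
Local Notation leb := (@lebesgue_measure R).
Local Notation P := (normal_prob 0 sigma).
Local Notation pdf := (normal_pdf 0 sigma).

Let s2 : 0 < sigma ^+ 2. Proof. by rewrite exprn_even_gt0. Qed.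

Lemma normal_pdf0E (s y : R) : s != 0 ->
  normal_pdf 0 s y = normal_peak s * expR (- (y ^+ 2 / (2 * s ^+ 2))).
Proof.
move=> s0; rewrite normal_pdfE// /normal_fun subr0 mulNr.
by congr (_ * expR (- (_ / _))); rewrite mulr_natl.
Qed.

(** Part of the Gaussian decay absorbs the power, by w^m <= m! exp(w); what remains is the decay for
    the doubled parameter. *)
Lemma even_pow_pdf_le (m : nat) : exists2 c : R, 0 <= c &
  forall y, y ^+ (2 * m) * pdf y <= c * normal_pdf 0 (2 * sigma) y.
Proof.
have s20 : 2 * sigma != 0 by rewrite mulf_neq0.
have pk := normal_peak_gt0 sigma0; have pk2 := normal_peak_gt0 s20.
pose r := normal_peak sigma / normal_peak (2 * sigma).
have r0 : 0 <= r by rewrite divr_ge0// ltW.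
(* Determined by 1/q = 1/(2 sigma^2) - 1/(8 sigma^2), the difference of the two Gaussian
   exponents. *)
pose q := 8 * sigma ^+ 2 / 3.
have q0 : 0 < q by rewrite divr_gt0// mulr_gt0.
exists (r * (q ^+ m * m`!%:R)); first by rewrite mulr_ge0// mulr_ge0// exprn_ge0// ltW.
move=> y; rewrite !normal_pdf0E//; pose w := y ^+ 2 / q.
have w0 : 0 <= w by rewrite divr_ge0 ?sqr_ge0// ltW.
have wm : w ^+ m <= m`!%:R * expR w.
  case: m => [|m]; first by rewrite expr0 fact0 mul1r -[leLHS]expR0 ler_expR.
  rewrite mulrC -ler_pdivrMr; last by rewrite ltr0n fact_gt0.
  by apply: le_trans (expR_ge1Dxn m w0); rewrite lerDr.
have -> : y ^+ (2 * m) = q ^+ m * w ^+ m.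
  by rewrite -exprMn exprM /w; congr (_ ^+ m); field; rewrite gt_eqF.
have -> : - (y ^+ 2 / (2 * sigma ^+ 2)) = - w - y ^+ 2 / (2 * (2 * sigma) ^+ 2).
  by rewrite /w /q; field; rewrite sigma0.
rewrite expRD; set E := expR (- (y ^+ 2 / (2 * (2 * sigma) ^+ 2))).
have E0 : 0 <= E by exact: expR_ge0.
apply: (@le_trans _ _ (q ^+ m * (m`!%:R * expR w) * (normal_peak sigma * (expR (- w) * E)))).
  rewrite ler_wpM2r ?mulr_ge0 ?expR_ge0 ?(ltW pk)//.
  by rewrite ler_wpM2l ?exprn_ge0 ?(ltW q0).
rewrite expRN; apply: ler_eq; rewrite /r; have := expR_gt0 w.
by move: (expR w) => ew ew0; field; rewrite ?gt_eqF.
Qed.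

(** From |y|^k <= 1 + y^(2k), the even case covers every power. *)
Lemma pow_pdf_le (k : nat) : exists2 c : R, 0 <= c &
  forall y, `|y ^+ k * pdf y| <= c * normal_pdf 0 (2 * sigma) y.
Proof.
have [c0 c00 c0P] := even_pow_pdf_le 0; have [c1 c10 c1P] := even_pow_pdf_le k.
exists (c0 + c1); first by rewrite addr_ge0.
move=> y; have pdf0 : 0 <= pdf y by exact: normal_pdf_ge0.
rewrite normrM (ger0_norm pdf0) mulrDl; apply: le_trans (lerD (c0P y) (c1P y)).
rewrite muln0 expr0 -mulrDl ler_wpM2r// normrX mulnC exprM.
rewrite -[(y ^+ k) ^+ 2]real_normK ?num_real// normrX.
have : 0 <= `|y| ^+ k by rewrite exprn_ge0.
by move: (`|y| ^+ k) => z z0; nra.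
Qed.

Lemma integrable_pow_pdf (k : nat) :
  leb.-integrable setT (fun y => (y ^+ k * pdf y)%:E).
Proof.
have [c c0 cP] := pow_pdf_le k.
apply: (@le_integrable _ _ _ leb setT measurableT _
  (fun y => c%:E * (normal_pdf 0 (2 * sigma) y)%:E)%E).
- apply/measurable_EFinP; apply: measurable_funM.
    by apply: measurable_funX; exact: measurable_id.
  exact: measurable_normal_pdf.
- move=> y _ /=; rewrite lee_fin [leRHS]ger0_norm//.
  by rewrite mulr_ge0// normal_pdf_ge0.
- by apply: integrableZl => //; exact: integrable_normal_pdf.
Qed.

(** The Radon-Nikodym derivative of the law and the density [pdf] have the same integral over every
    measurable set, hence agree almost everywhere. *)
Lemma ge0_integral_normal_prob (f : R -> \bar R) : (forall y, 0 <= f y)%E ->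
  measurable_fun setT f -> (\int[P]_y f y = \int[leb]_y (f y * (pdf y)%:E))%E.
Proof.
move=> f0 mf.
rewrite -(@Radon_Nikodym_SigmaFinite.change_of_variables _ _ _ P leb)//; last first.
  exact: normal_prob_dominates.
apply: ae_eq_integral => //.
- apply: emeasurable_funM => //; apply: (measurable_int leb).
  exact/Radon_Nikodym_SigmaFinite.f_integrable/normal_prob_dominates.
- by apply: emeasurable_funM => //; apply/measurable_EFinP; exact: measurable_normal_pdf.
- apply: ae_eqe_mul2l; apply: integral_ae_eq => //.
  + exact/Radon_Nikodym_SigmaFinite.f_integrable/normal_prob_dominates.
  + by apply/measurable_EFinP; exact: measurable_normal_pdf.
  + move=> B _ mB; rewrite -Radon_Nikodym_SigmaFinite.f_integral//.
    exact: normal_prob_dominates.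
Qed.

Lemma integrable_normal_pow (k : nat) : P.-integrable setT (fun y => (y ^+ k)%:E).
Proof.
have mk : measurable_fun setT (fun y : R => (y ^+ k)%:E).
  by apply/measurable_EFinP; apply: measurable_funX; exact: measurable_id.
apply/integrableP; split=> //.
rewrite ge0_integral_normal_prob//; last exact: measurableT_comp.
have /integrableP[_] := integrable_pow_pdf k; congr (_ < _)%E.
apply: eq_integral => y _; rewrite /= normrM EFinM; congr (_ * _%:E)%E.
by rewrite ger0_norm// normal_pdf_ge0.
Qed.

Lemma normal_moment_integral (k : nat) :
  \int[P]_y (y ^+ k) = \int[leb]_y (y ^+ k * pdf y).
Proof.
congr fine; rewrite [LHS]integralE [RHS]integralE; congr (_ - _)%E.
- rewrite ge0_integral_normal_prob//; last first.
    apply: measurable_funepos; apply/measurable_EFinP.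
    by apply: measurable_funX; exact: measurable_id.
  apply: eq_integral => y _; rewrite !funeposE -[0%E in RHS](mul0e (pdf y)%:E).
  by rewrite EFinM -maxe_pMl// lee_fin normal_pdf_ge0.
- rewrite ge0_integral_normal_prob//; last first.
    apply: measurable_funeneg; apply/measurable_EFinP.
    by apply: measurable_funX; exact: measurable_id.
  apply: eq_integral => y _; rewrite !funenegE -[0%E in RHS](mul0e (pdf y)%:E).
  by rewrite EFinM -mulNe -maxe_pMl// lee_fin normal_pdf_ge0.
Qed.

(** Set-up for integration by parts: the derivative [dW j] of [W j] has integral 0, and its two
    terms give the two sides of the moment recursion. At j = 0 the coefficient vanishes, so the
    truncated predecessor is harmless. *)
Let W (j : nat) (y : R) : R := y ^+ j * pdf y.
Let dW (j : nat) (y : R) : R := j%:R * y ^+ j.-1 * pdf y - y ^+ j.+1 * pdf y / sigma ^+ 2.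

Let is_derive_W j (y : R) : is_derive y 1 (W j) (dW j y).
Proof.
pose p : {poly R} := - (2 * sigma ^+ 2)^-1 *: 'X^2.
have pE z : p.[z] = - (z ^+ 2 / (2 * sigma ^+ 2)).
  by rewrite hornerZ hornerXn mulNr mulrC.
have dp : is_derive y 1 (fun z => p.[z]) (- (y / sigma ^+ 2)).
  have := is_derive_poly p y; congr is_derive.
  rewrite derivZ derivXn hornerZ hornerMn hornerXn expr1.
  by field; rewrite sigma0.
have dexp := is_derive1_comp (is_derive_expR p.[y]) dp.
have dpdf : is_derive y 1 pdf (- (y * pdf y / sigma ^+ 2)).
  have := is_deriveZ (normal_peak sigma) dexp.
  have -> : normal_peak sigma *: (expR p.[y] * - (y / sigma ^+ 2)) =
      - (y * pdf y / sigma ^+ 2).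
    rewrite normal_pdf0E// -pE -[LHS]/(normal_peak sigma * (expR p.[y] * - (y / sigma ^+ 2))).
    by ring.
  congr is_derive; apply/funext => z; rewrite normal_pdf0E// -pE.
  by [].
have dX := is_derive_poly ('X^j : {poly R}) y.
have := is_deriveM dX dpdf.
have -> : ('X^j).[y] *: - (y * pdf y / sigma ^+ 2) + pdf y *: ('X^j)^`().[y] = dW j y.
  rewrite derivXn hornerMn !hornerXn /dW [y ^+ j.+1]exprSr.
  rewrite -[LHS]/(y ^+ j * - (y * pdf y / sigma ^+ 2) + pdf y * (y ^+ j.-1 *+ j)).
  by rewrite -mulr_natl; ring.
congr is_derive; apply/funext => z; rewrite /W -[LHS]/(('X^j).[z] * pdf z).
by rewrite hornerXn.
Qed.

Let continuous_dW j : continuous (dW j).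
Proof.
have cpdf : continuous pdf by exact: continuous_normal_pdf.
have cX i : continuous (fun y : R => y ^+ i) by exact: exprn_continuous.
move=> y; apply: cvgB.
- by apply: cvgM; [apply: cvgM; [exact: cvg_cst|exact: cX]|exact: cpdf].
- by apply: cvgM; [apply: cvgM; [exact: cX|exact: cpdf]|exact: cvg_cst].
Qed.

Let integrable_dW j : leb.-integrable setT (EFin \o dW j).
Proof.
have i1 := integrableZl measurableT j%:R (integrable_pow_pdf j.-1).
have i2 := integrableZl measurableT (sigma ^+ 2)^-1 (integrable_pow_pdf j.+1).
have := integrableB measurableT i1 i2; apply: eq_integrable => // y _.
by rewrite /= -!EFinM -EFinB /dW; congr (_%:E); ring.
Qed.

(** Boundedness of |y|^(j+1) times the density gives decay 1/|y|; the sign [e] treats both ends of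
    the line. *)
Let W_cvg0 j (e : R) : `|e| = 1 -> (fun n => W j (e * n.+1%:R)) @ \oo --> 0.
Proof.
move=> e1; have [c c0 cP] := pow_pdf_le j.+1.
have s20 : 2 * sigma != 0 by rewrite mulf_neq0.
pose K := c * normal_peak (2 * sigma).
have bnd n : `|W j (e * n.+1%:R)| <= K * n.+1%:R^-1.
  rewrite ler_pdivlMr// -[leLHS]/(`|W j (e * n.+1%:R)| * n.+1%:R).
  have -> : `|W j (e * n.+1%:R)| * n.+1%:R =
      `|(e * n.+1%:R) ^+ j.+1 * pdf (e * n.+1%:R)|.
    rewrite /W !normrM exprSr normrM [`|e * _|]normrM e1 mul1r.
    by rewrite (ger0_norm (ler0n _ n.+1)); ring.
  by apply: (le_trans (cP _)); rewrite ler_wpM2l// normal_pdf_ub.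
apply/norm_cvg0P.
apply: (@squeeze_cvgr _ _ _ _ (fun=> 0) (fun n => K * n.+1%:R^-1)).
- by apply/nearW => n; rewrite bnd normr_ge0.
- exact: cvg_cst.
- by rewrite -[X in _ --> X](mulr0 K); apply: cvgM; [exact: cvg_cst|exact: cvg_harmonic].
Qed.

(** Dominated convergence along growing symmetric intervals, on which the fundamental theorem of
    calculus leaves only boundary values of [W j]. *)
Let integral_dW j : \int[leb]_y dW j y = 0.
Proof.
pose I n : set R := `[- (n.+1%:R : R), n.+1%:R]%classic.
pose fn n (y : R) : \bar R := ((EFin \o dW j) \_ (I n)) y.
have FTC n : (\int[leb]_y fn n y = (W j n.+1%:R - W j (- n.+1%:R))%:E)%E.
  rewrite -integral_mkcond (@continuous_FTC2 _ (dW j) (W j))//.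
  - by rewrite gtrN.
  - exact: continuous_subspaceT.
  - have cW : continuous (W j).
      move=> y; apply: differentiable_continuous; apply/derivable1_diffP.
      by case: (is_derive_W j y).
    split; first by move=> y _; case: (is_derive_W j y).
    + exact/cvg_at_right_filter/cW.
    + exact/cvg_at_left_filter/cW.
  - move=> y _; rewrite derive1E; exact: (@derive_val _ _ _ _ _ _ _ (is_derive_W j y)).
have mdW : measurable_fun setT (EFin \o dW j) by case/integrableP: (integrable_dW j).
have [|||||_ _] := @dominated_convergence _ _ _ leb setT measurableT fn (EFin \o dW j)
  (fun y => `|(EFin \o dW j) y|)%E.
- move=> n; have mI : measurable (I n) by exact: measurable_itv.
  by apply/(measurable_restrict _ mI measurableT); exact: measurable_funTS.
- exact: mdW.
- apply/aeW => y _; apply: cvg_near_cst.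
  near=> n; rewrite /fn patchE ifT// inE /I /= in_itv/= -ler_norml.
  apply: (@le_trans _ _ n%:R); last by rewrite ler_nat.
  by near: n; exact: nbhs_infty_ger.
- exact: (integrable_abse (integrable_dW j)).
- apply/aeW => y n _; rewrite /fn patchE; case: ifP => // _.
  by rewrite abse0.
under eq_fun do rewrite FTC.
rewrite /Rintegral => /cvg_lim <-//.
suff : (fun n => (W j n.+1%:R - W j (- n.+1%:R))%:E) @ \oo --> 0%:E.
  by move=> /cvg_lim ->.
apply: cvg_EFin; first by apply/nearW.
have e1 : `|1| = 1 :> R by rewrite normr1.
have eN1 : `|-1| = 1 :> R by rewrite normrN1.
rewrite [X in X @ _ --> _](_ : _ = (fun n => W j (1 * n.+1%:R)) -
    (fun n => W j (-1 * n.+1%:R))); last first.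
  apply/funext => n; rewrite /= -[RHS]/(W j (1 * n.+1%:R) - W j (-1 * n.+1%:R)).
  by rewrite mul1r mulN1r.
by rewrite -(subrr 0); apply: cvgB; exact: W_cvg0.
Unshelve. all: by end_near.
Qed.

(** The instance j = 0 is the vanishing of the mean; the others are the recursion by two steps. *)
Lemma normal_moment_rec (j : nat) :
  \int[P]_y (y ^+ j.+1) = j%:R * sigma ^+ 2 * \int[P]_y (y ^+ j.-1).
Proof.
rewrite !normal_moment_integral; have := integral_dW j.
have i1 := integrable_pow_pdf j.-1; have i2 := integrable_pow_pdf j.+1.
rewrite [X in X = 0 -> _](_ : _ = j%:R * \int[leb]_y (y ^+ j.-1 * pdf y) -
    (sigma ^+ 2)^-1 * \int[leb]_y (y ^+ j.+1 * pdf y)).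
  move/eqP; rewrite subr_eq0 => /eqP E.
  by rewrite mulrAC E; field; rewrite sigma0.
have i1' := integrableZl measurableT j%:R i1.
have i2' := integrableZl measurableT (sigma ^+ 2)^-1 i2.
rewrite -(RintegralZl _ measurableT i1) -(RintegralZl _ measurableT i2).
rewrite -(RintegralB measurableT i1' i2'); apply: eq_Rintegral => y _.
by rewrite /dW; ring.
Qed.

End gaussian_moments.

(** * Convergence of moments *)

Section gaussian_growth.
Context {R : realType}.
Variables (sigma : R) (mom : nat -> R).
Hypotheses (mom0 : mom 0 = 1)
  (momS : forall k, mom k.+2 = k.+1%:R * sigma ^+ 2 * mom k).

(** The recursion amounts to mom(2n) = (2n)! sigma^(2n) / (2^n n!). The mean Taylor error of order
    2n is thus a term of an exponential series and tends to 0. *)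
Lemma even_moment_coeff (t : R) (n : nat) :
  t ^+ (2 * n) / (2 * n)`!%:R * mom (2 * n) = exp_coeff (t ^+ 2 * sigma ^+ 2 / 2) n.
Proof.
elim: n => [|n IH].
  by rewrite muln0 expr0 fact0 mom0 mulr1 divr1 exp_coeffE expr0 mulr1 invr1.
have f0 (i : nat) : (i`!%:R : R) != 0 by rewrite pnatr_eq0 -lt0n fact_gt0.
have i0 (i : nat) : (i.+1%:R : R) != 0 by [].
have -> : exp_coeff (t ^+ 2 * sigma ^+ 2 / 2) n.+1 = t ^+ 2 * sigma ^+ 2 / 2 / n.+1%:R *
    exp_coeff (t ^+ 2 * sigma ^+ 2 / 2) n.
  move: (t ^+ 2 * sigma ^+ 2 / 2) => x.
  by rewrite !exp_coeffE [x ^+ n.+1]exprS factS natrM invfM; ring.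
rewrite -IH; have -> : (2 * n.+1 = (2 * n).+2)%N by lia.
rewrite momS !factS !natrM [t ^+ (2 * n).+2]exprS [t ^+ (2 * n).+1]exprS.
have -> : ((2 * n).+2%:R : R) = 2 * n.+1%:R by rewrite -natrM; congr (_%:R); lia.
have := f0 (2 * n)%N; have := i0 n; have := i0 (2 * n)%N.
move: ((2 * n)`!%:R : R) (n.+1%:R : R) ((2 * n).+1%:R : R) => x y z z0 y0 x0.
by field; rewrite x0 y0 z0.
Qed.

Lemma even_moment_growth (t eps : R) : 0 < eps -> exists n : nat,
  t ^+ (2 * n) / (2 * n)`!%:R * mom (2 * n) < eps.
Proof.
move=> eps0; have := is_cvg_series_exp_coeff (t ^+ 2 * sigma ^+ 2 / 2).
move=> /cvg_series_cvg_0/cvgrPdist_lt/(_ eps eps0)[n _ /(_ n (leqnn n))] /= h.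
exists n; rewrite even_moment_coeff; move: h; rewrite sub0r normrN.
by apply: le_lt_trans; exact: ler_norm.
Qed.

End gaussian_growth.

(** The exponent is the least even number that is at least [m]; this trades an absolute moment for a
    genuine one. *)
Lemma expr_norm_le_even {R : realType} (m : nat) (y : R) :
  `|y| ^+ m <= 1 + y ^+ (uphalf m).*2.
Proof.
have -> : y ^+ (uphalf m).*2 = `|y| ^+ (uphalf m).*2.
  by rewrite -normrX ger0_norm// exprn_even_ge0// odd_double.
have m2 : (m <= (uphalf m).*2)%N.
  by rewrite -[m in (m <= _)%N]odd_double_half uphalf_half doubleD; case: odd; lia.
have [y1|y1] := leP `|y| 1.
  by apply: (@le_trans _ _ 1); [exact: exprn_ile1|rewrite lerDl exprn_ge0].
apply: (@le_trans _ _ (`|y| ^+ (uphalf m).*2)); last by rewrite lerDr.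
by apply: ler_weXn2l => //; exact: ltW.
Qed.

Section moment_convergence.
Context {R : realType} {H : pseudoPMetricType R}.
Variables (mul : H -> H -> H) (inv : H -> H) (e : H) (d : H -> H -> R).
Context {dX : measure_display} {X : measurableType dX}.
Variables (mu : probability X R) (act : H -> X -> X).
Variables (A : set (X -> R)) (N : nat -> (X -> R) -> R).
Variable nu : nat -> {finite_measure set (borel_of H) -> \bar R}.
Hypothesis groupH : lcsc_group_with_left_invariant_metric mul inv e d.
Hypothesis actH : mp_action mul e mu act.
Hypothesis algA : invariant_subalgebra mu inv act A.
Hypothesis semiN : admissible_seminorms mu inv e d act A N.
Hypothesis mixing : exp_mixing_all_orders mu inv d act A N.
Variables (f : X -> R) (M sigma : R) (mom : nat -> R).
Hypotheses (Af : A f) (mean0 : \int[mu]_x f x = 0).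
Hypotheses (M0 : 0 <= M) (fM : {ae mu, forall x, `|f x| <= M}).
Let n T : R := fine (nu T [set: borel_of H]).
Hypothesis mass : n @ \oo --> +oo.
Hypothesis concentration : forall r : nat, (3 <= r)%N -> forall c : R, 0 < c ->
  (fun T => (\int[nu T]_h nu T (dball d h (c * ln (n T))%R) ^+ r.-1)%E) @ \oo --> 0%E.
Hypotheses (mom0 : mom 0 = 1) (mom1 : mom 1 = 0)
  (momS : forall k, mom k.+2 = k.+1%:R * sigma ^+ 2 * mom k).

Local Notation F T := (cpart inv act f M (nu T) setT).
Let Mo (k T : nat) : R := \int[mu]_x (F T x ^+ k).

Let bF T : bounded_mfun (F T).
Proof. exact: (bounded_mfun_cpart groupH actH algA Af M0). Qed.

Let Mo1 T : Mo 1 T = 0.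
Proof.
rewrite /Mo; transitivity (\int[mu]_x (1 * F T x)).
  by apply: eq_Rintegral => x _; rewrite expr1 mul1r.
rewrite (mean_cpart groupH actH algA Af M0 _ measurableT (bounded_mfun_cst 1)).
rewrite (_ : (fun h : borel_of H => _) = cst 0) ?Rintegral_cst ?mul0r//.
apply/funext => h /=; transitivity (\int[mu]_x translate inv act h (clip M f) x).
  by apply: eq_Rintegral => x _; rewrite mul1r.
have := mean_pclip actH algA Af M0 fM [:: h].
under eq_Rintegral do rewrite big_seq1.
under [X in _ = X -> _]eq_Rintegral do rewrite big_seq1.
by move=> ->; rewrite (algebra_mean_translate actH algA).
Qed.

Let ball_mass_cvg0 (b : R) (j : nat) : 0 < b -> (2 <= j)%N ->
  (fun T => \int[nu T]_(h in [set: borel_of H]) (fine (nu T (dball d h (b * ln (n T)))) ^+ j))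
    @ \oo --> 0.
Proof.
move=> b0 j2; have := @concentration j.+1 j2 b b0 => /fine_cvg.
rewrite /=; apply: cvg_trans; apply: near_eq_cvg; apply/nearW => T /=.
congr fine; apply: eq_integral => h _; rewrite EFin_expe fineK// fin_num_measure//.
exact: (measurable_dball groupH).
Qed.

Hypothesis second : Mo 2 @ \oo --> sigma ^+ 2.

(** The even moment only has to stay bounded: it multiplies a ball integral that tends to 0. *)
Let moment_step m : Mo (uphalf m).*2 @ \oo --> mom (uphalf m).*2 ->
  Mo m.+1 @ \oo --> mom m.+1 -> Mo m.+3 @ \oo --> mom m.+3.
Proof.
move=> cq c1.
have [b b0 [K K0 rec]] := moment_recursion groupH actH algA semiN mixing Af mean0 M0 fM m.
pose I j T := \int[nu T]_(h in [set: borel_of H]) (fine (nu T (dball d h (b * ln (n T)))) ^+ j).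
pose err T := K * ((1 + Mo (uphalf m).*2 T) * I 2 T + I m.+2 T + (n T)^-1).
have err0 : err @ \oo --> 0.
  rewrite -[X in _ --> X](mulr0 K); apply: cvgM; first exact: cvg_cst.
  rewrite -[X in _ --> X]addr0; apply: cvgD; last first.
    by apply/gtr0_cvgV0 => //; move/cvgryPgt : mass; exact.
  rewrite -[X in _ --> X]addr0; apply: cvgD; last exact: ball_mass_cvg0.
  rewrite -[X in _ --> X](mulr0 (1 + mom (uphalf m).*2)).
  apply: cvgM; last exact: ball_mass_cvg0.
  by apply: cvgD => //; exact: cvg_cst.
have diff0 : (fun T => Mo m.+3 T - m.+2%:R * Mo 2 T * Mo m.+1 T) @ \oo --> 0.
  apply/norm_cvg0P; apply: (@squeeze_cvgr _ _ _ _ (fun=> 0) err) => //; last exact: cvg_cst.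
  near=> T; rewrite normr_ge0/=.
  have n1 : 1 <= n T by near: T; move/cvgryPge : mass; exact.
  apply: (le_trans (rec (nu T) n1)); rewrite /err ler_wpM2l// -/(I 2 T) -/(I m.+2 T).
  rewrite lerD2r lerD2r ler_wpM2r//.
    by apply: Rintegral_ge0 => h _; exact: sqr_ge0.
  have -> : 1 + Mo (uphalf m).*2 T = \int[mu]_x (1 + F T x ^+ (uphalf m).*2).
    by rewrite meanD ?mean_cst//; [exact: bounded_mfun_cst|exact: bounded_mfunX].
  apply: le_mean => [||x]; last exact: expr_norm_le_even.
  - by apply: bounded_mfunX; exact: bounded_mfun_norm.
  - by apply: bounded_mfunD; [exact: bounded_mfun_cst|exact: bounded_mfunX].
rewrite momS -[X in _ --> X]add0r (_ : Mo m.+3 = fun T =>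
    (Mo m.+3 T - m.+2%:R * Mo 2 T * Mo m.+1 T) + m.+2%:R * Mo 2 T * Mo m.+1 T).
  apply: cvgD diff0 _; apply: cvgM c1; apply: cvgM second; exact: cvg_cst.
by apply/funext => T; rewrite subrK.
Unshelve. all: by end_near.
Qed.

Lemma moments_cvg (k : nat) : (fun T => \int[mu]_x (F T x ^+ k)) @ \oo --> mom k.
Proof.
rewrite -/(Mo k).
(* Order m+3 needs order m+1 and the even order, itself at most m+1. Order 2 is the assumption on
   the variance. *)
elim/ltn_ind: k => -[|[|[|m]]] IH.
- rewrite mom0 (_ : Mo 0 = cst 1); first exact: cvg_cst.
  by apply/funext => T; rewrite /Mo; under eq_Rintegral do rewrite expr0; rewrite mean_cst.
- by rewrite mom1 (_ : Mo 1 = cst 0); [exact: cvg_cst|apply/funext => T].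
- by rewrite momS mom0 mul1r mulr1.
- apply: moment_step; apply: IH => //.
  by rewrite uphalf_half -[m in (_ < m.+3)%N]odd_double_half doubleD; case: odd; lia.
Qed.

End moment_convergence.

(** * Convergence in distribution *)

(** The limit is a random variable [Z] on any probability space, so that a constant is as admissible
    as a Gaussian variable. *)
Lemma method_of_moments {R : realType} {dX dY : measure_display}
    {X : measurableType dX} {Y : measurableType dY}
    (mu : probability X R) (P : probability Y R) (F : nat -> X -> R) (Z : Y -> R)
    (sigma : R) (phi : R -> R) :
  (forall T, bounded_mfun (F T)) -> measurable_fun setT Z ->
  (forall k, P.-integrable setT (fun y => (Z y ^+ k)%:E)) ->
  (forall k, \int[P]_y (Z y ^+ k.+2) = k.+1%:R * sigma ^+ 2 * \int[P]_y (Z y ^+ k)) ->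
  (forall k, (fun T => \int[mu]_x (F T x ^+ k)) @ \oo --> \int[P]_y (Z y ^+ k)) ->
  continuous phi -> (exists M : R, forall y, `|phi y| <= M) ->
  (fun T => \int[mu]_x phi (F T x)) @ \oo --> \int[P]_y phi (Z y).
Proof.
move=> bF mZ iZ momS cvgF cphi bphi.
have mF T : measurable_fun setT (F T) by case: (bF T).
have test k : cvg_test mu P F Z (fun y => y ^+ k).
  split; [exact: measurable_funX| |exact: iZ|exact: cvgF].
  by move=> T; apply: bounded_mfun_integrable => //; exact: bounded_mfunX.
have mom0 : \int[P]_y (Z y ^+ 0) = 1.
  by under eq_Rintegral do rewrite expr0; rewrite mean_cst.
have growth := even_moment_growth (mom := fun k => \int[P]_y (Z y ^+ k)) mom0 momS.
by have [] := cvg_test_bounded_continuous mF mZ test growth cphi bphi.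
Qed.

(** Turns the assumption on the L^2 norms into convergence of the second moments of the truncated
    averages. *)
Lemma Lnorm2_sqr {R : realType} {dX : measure_display} {X : measurableType dX}
    (mu : probability X R) (g F : X -> R) : measurable_fun setT g -> bounded_mfun F ->
  {ae mu, forall x, g x = F x} ->
  fine (Lnorm mu 2%:E (fun x => (g x)%:E)) ^+ 2 = \int[mu]_x (F x ^+ 2).
Proof.
move=> mg bF gF; have [mF _] := bF.
have int_eq : (\int[mu]_x `|(g x)%:E| `^ 2 = (\int[mu]_x (F x ^+ 2))%:E)%E.
  transitivity (\int[mu]_x (F x ^+ 2)%:E)%E; last first.
    rewrite /Rintegral fineK//; apply: integrable_fin_num => //.
    by apply: bounded_mfun_integrable => //; exact: bounded_mfunX.
  under eq_integral do rewrite abse_EFin poweR_EFin powR_mulrn// real_normK ?num_real//.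
  apply: ae_eq_integral => //; try by apply/measurable_EFinP; exact: measurable_funX.
  by apply: filterS gF => x -> _.
have := @poweR_Lnorm _ X R mu (fun x => (g x)%:E) 2; rewrite int_eq.
move=> /(_ _); rewrite pnatr_eq0 => /(_ isT).
have := Lnorm_ge0 mu 2%:E (fun x => (g x)%:E).
case: (Lnorm _ _ _) => [r|_|//]; last by rewrite poweRyr// pnatr_eq0.
by rewrite lee_fin poweR_EFin => r0 [<-]; rewrite powR_mulrn.
Qed.

Theorem theorem1p5 (R : realType) (H : pseudoPMetricType R)
    (mul : H -> H -> H) (inv : H -> H) (e : H) (d : H -> H -> R)
    (dX : measure_display) (X : measurableType dX) (mu : probability X R)
    (act : H -> X -> X) (A : set (X -> R)) (N : nat -> (X -> R) -> R)
    (nu : nat -> {finite_measure set (borel_of H) -> \bar R})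
    (f : X -> R) (sigma_f : R) :
  lcsc_group_with_left_invariant_metric mul inv e d ->
  mp_action mul e mu act ->
  invariant_subalgebra mu inv act A ->
  admissible_seminorms mu inv e d act A N ->
  exp_mixing_all_orders mu inv d act A N ->
  (* ||nu_T|| -> oo *)
  (fun T => fine (nu T [set: borel_of H])) @ \oo --> +oo ->
  (* the ball-concentration condition *)
  (forall r : nat, (3 <= r)%N -> forall c : R, 0 < c ->
     (fun T => (\int[nu T]_h
        nu T (dball d h (c * ln (fine (nu T [set: borel_of H]))%R)) ^+ r.-1)%E)
       @ \oo --> 0%E) ->
  A f -> mean mu f = 0 ->
  (* sigma_f = lim ||nu_T * f||_{L^2} exists (and is finite) *)
  (fun T => Lnorm mu 2%:E (fun x => (conv_action inv act (nu T) f x)%:E))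
    @ \oo --> sigma_f%:E ->
  cvg_dist_to_centered_gaussian mu (fun T => conv_action inv act (nu T) f) sigma_f.
Proof.
move=> groupH actH algA semiN mixing mass concentration Af mean0 norm_cvg.
have [M M0 fM] : exists2 M : R, 0 <= M & {ae mu, forall x, `|f x| <= M}.
  case: algA => /(_ f Af)[_ [M fM]] _ _ _ _; exists `|M| => //.
  by apply: filterS fM => x /le_trans; apply; exact: ler_norm.
pose F T := cpart inv act f M (nu T) setT.
have bF T : bounded_mfun (F T) by exact: (bounded_mfun_cpart groupH actH algA Af M0).
have convF T := ae_eq_conv_action groupH actH algA Af M0 fM (nu T).
have mconv T := measurable_conv_action groupH actH algA Af (nu T).
have second : (fun T => \int[mu]_x (F T x ^+ 2)) @ \oo --> sigma_f ^+ 2.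
  under eq_fun do rewrite -(Lnorm2_sqr (mconv _) (bF _) (convF _)).
  by apply: cvgM; exact: (fine_cvg norm_cvg).
(* Stated for any sequence obeying the recursion, to serve both the degenerate and the Gaussian
   limit. *)
have moments (mom : nat -> R) : mom 0 = 1 -> mom 1 = 0 ->
    (forall k, mom k.+2 = k.+1%:R * sigma_f ^+ 2 * mom k) ->
    forall k, (fun T => \int[mu]_x (F T x ^+ k)) @ \oo --> mom k.
  move=> mom0 mom1 momS; exact: (moments_cvg groupH actH algA semiN mixing Af mean0 M0
    fM mass concentration mom0 mom1 momS second).
move=> phi cphi bphi.
have phiE T : fine (\int[mu]_x (phi (conv_action inv act (nu T) f x))%:E)%E =
    \int[mu]_x phi (F T x).
  have mphi : measurable_fun setT phi by exact: continuous_measurable_fun.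
  apply: ae_eq_mean; first exact: measurableT_comp.
    by apply: measurableT_comp => //; case: (bF T).
  by apply: filterS (convF T) => x ->.
under eq_fun do rewrite phiE.
rewrite /centered_gaussian_expect; have [sigma0|sigma0] := eqVneq sigma_f 0.
(* Zero variance: the limit variable is the constant 0 on [X] itself, whose moments obey the same
   recursion. *)
- have zmom k : \int[mu]_x ((0 : R) ^+ k) = 0 ^+ k by exact: mean_cst.
  have momS k : \int[mu]_x ((0 : R) ^+ k.+2) =
      k.+1%:R * sigma_f ^+ 2 * \int[mu]_x ((0 : R) ^+ k).
    by rewrite !zmom sigma0 !expr0n/= mulr0 mul0r.
  rewrite -(mean_cst mu (phi 0)).
  apply: (@method_of_moments _ _ _ _ _ mu mu F (fun _ => 0) sigma_f) => //.
  + by move=> k; apply: bounded_mfun_integrable => //; exact: bounded_mfun_cst.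
  + by apply: (moments (fun k => \int[mu]_x ((0 : R) ^+ k))) => //=; rewrite zmom ?expr0 ?expr1.
- have norm1 : \int[normal_prob 0 sigma_f]_y (y ^+ 0) = 1.
    by under eq_Rintegral do rewrite expr0; rewrite mean_cst.
  have momS k := normal_moment_rec sigma0 k.+1.
  apply: (@method_of_moments _ _ _ _ _ mu (normal_prob 0 sigma_f) F id sigma_f) => //.
  + exact: integrable_normal_pow.
  + apply: (moments (fun k => \int[normal_prob 0 sigma_f]_y (y ^+ k))) => //=.
    by rewrite (normal_moment_rec sigma0 0) !mul0r.
Qed.
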